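(* Let $m>4$. The operator $\mathcal C^{(0)}$ is not a bounded map from $L^\infty_m$ to $L^\infty_m$. More precisely, there exists a sequence $\{\eta_n\}_{n\gg1}\subset L^\infty_m$ such that \[ \sup_n\|\eta_n\|_{L^\infty_m}<\infty, \] but \[ \sup_{\sigma=\pm1}\sup_{k\in\mathbb R^2}\langle k\rangle^m\left|\mathcal C^{(0)}(\eta_n)(\sigma,k)\right|\longrightarrow\infty\qquad\text{as }n\to\infty . \]
   Context: Modes and notation. A mode is $\alpha=(\sigma_\alpha,k_\alpha)$ with $\sigma_\alpha\in\{\pm1\}$ and $k_\alpha=(k_\alpha^1,k_\alpha^2)\in\mathbb R^2$ (superscripts are components); for $k_\alpha\ne0$ write $k_\alpha=|k_\alpha|(\cos\theta_\alpha,\sin\theta_\alpha)$; same conventions for $\beta,\gamma$. Put $\langle k\rangle=(1+|k|^2)^{1/2}$. The dispersion relation is $\omega_\alpha=\sigma_\alpha k_\alpha^1/|k_\alpha|=\sigma_\alpha\cos\theta_\alpha$. The interaction coefficient is \[ \Gamma_{\alpha\beta\gamma}=\pi^2(\sigma_\alpha\sin\theta_\alpha+\sigma_\beta\sin\theta_\beta+\sigma_\gamma\sin\theta_\gamma)(\sigma_\alpha|k_\alpha|+\sigma_\beta|k_\beta|+\sigma_\gamma|k_\gamma|). \] Zero-frequency cut-off only. Fix $0<\varepsilon\ll1$ (sufficiently small). $\chi_{0,\varepsilon}$ is a smooth $2\pi$-periodic function with $0\le\chi_{0,\varepsilon}\le1$, depending only on $|\cos\theta|$, with $\chi_{0,\varepsilon}(\theta)=0$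 if $|\cos\theta|<\varepsilon$ and $\chi_{0,\varepsilon}(\theta)=1$ if $|\cos\theta|>2\varepsilon$. In particular no localization is imposed near $|\cos\theta|=\tfrac12$. Collision operator. Formally, with $\int d\beta=\sum_{\sigma_\beta=\pm1}\int_{\mathbb R^2}dk_\beta$, \[ \mathcal C^{(0)}(n)(\alpha)=\int\Gamma_{\alpha\beta\gamma}^2\,\omega_\alpha\,\chi_{0,\varepsilon}(\theta_\alpha)\chi_{0,\varepsilon}(\theta_\beta)\chi_{0,\varepsilon}(\theta_\gamma)\big(\omega_\alpha n_\beta n_\gamma+\omega_\gamma n_\alpha n_\beta+\omega_\beta n_\alpha n_\gamma\big)\,\delta(k_\alpha+k_\beta+k_\gamma)\,\delta(\omega_\alpha+\omega_\beta+\omega_\gamma)\,d\beta\,d\gamma . \] The delta functions are interpreted by the co-area formula: for $k_\alpha\ne0$, $\int F\,\delta(k_\alpha+k_\beta+k_\gamma)\delta(\omega_\alpha+\omega_\beta+\omega_\gamma)\,d\beta\,d\gamma$ means \[ \sum_{\sigma_\beta,\sigma_\gamma=\pm1}\int_{\mathcal R_\alpha}F\,\frac{d\mathcal H^1(k_\beta,k_\gamma)}{J}, \] where $\mathcal R_\alpha=\{(k_\beta,k_\gamma)\in(\mathbb R^2\setminus\{0\})^2: k_\alpha+k_\beta+k_\gamma=0,\ \omega_\alpha+\omega_\beta+\omega_\gamma=0\}$, $\mathcal H^1$ is one-dimensional Hausdorff measure and $J=\sqrt{\det(DD^{\top})}$ with $D$ the Jacobian matrix in $(k_\beta,k_\gamma)$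 of the map $(k_\beta,k_\gamma)\mapsto(\omega_\alpha+\omega_\beta+\omega_\gamma,\ k_\alpha+k_\beta+k_\gamma)\in\mathbb R^3$ (the integral is over the regular part $J\ne0$). The angle of the zero wave vector is undefined; by convention $\mathcal C^{(0)}(n)(\sigma,0)=0$. Space. For $m\in\mathbb R$, $L^\infty_m$ is the set of (Borel measurable) $n:\{\pm1\}\times\mathbb R^2\to\mathbb R_{\ge0}$ with $\|n\|_{L^\infty_m}=\sup_{\sigma=\pm1}\sup_{k\in\mathbb R^2}\langle k\rangle^m|n(\sigma,k)|<\infty$. We write $n_\alpha=n(\sigma_\alpha,k_\alpha)$. *)

(* Defs.v *)
From HB Require Import structures.
From mathcomp Require Import all_boot all_order all_algebra.
From mathcomp Require Import all_classical all_reals all_analysis.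

Set Implicit Arguments.
Unset Strict Implicit.
Unset Printing Implicit Defensive.

Import Order.TTheory GRing.Theory Num.Theory.
Import numFieldNormedType.Exports.

Local Open Scope classical_set_scope.
Local Open Scope ring_scope.

(* The library norm on row vectors is the sup norm (it induces the same
   topology and derivatives); all lengths and diameters below are Euclidean. *)
Definition enorm (R : realType) (n : nat) (v : 'rV[R]_n) : R :=
  Num.sqrt (\sum_(i < n) v 0 i ^+ 2).

Section Hausdorff.
Context {R : realType} {n : nat}.
Local Open Scope ereal_scope.
Implicit Types (A : set 'rV[R]_n) (F : (set 'rV[R]_n)^nat) (delta : R).

(* The point 0 makes the diameter of the empty set equal to 0. *)
Definition diam A : \bar R :=
  ereal_sup (0 |` [set (enorm (p.1 - p.2))%:E | p in A `*` A]).

Definition hausdorff1_pre delta A : \bar R :=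
  ereal_inf [set \sum_(k <oo) diam (F k) | F in
    [set F | (forall k, diam (F k) <= delta%:E) /\ A `<=` \bigcup_k F k]].

Definition hausdorff1 A : \bar R :=
  ereal_sup [set hausdorff1_pre delta A | delta in [set delta | (0 < delta)%R]].

Lemma diam_ge0 A : 0 <= diam A.
Proof. by apply: ereal_sup_ubound; left. Qed.

Lemma diam0 : diam set0 = 0.
Proof.
apply/eqP; rewrite eq_le diam_ge0 andbT; apply: ge_ereal_sup => x [->//|].
by move=> [p [[]]].
Qed.

(* hausdorff1_pre delta is the outer measure generated, on the discrete
   sigma-algebra, by the set function that is diam on sets of diameter at most
   delta and +oo on the others. *)
Let discrete : measurableType _ := g_sigma_algebraType [set: set 'rV[R]_n].

Let gauge delta (A : set discrete) : \bar R :=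
  if diam A <= delta%:E then diam A else +oo.

Let gauge_ge0 delta (A : set discrete) : 0 <= gauge delta A.
Proof. by rewrite /gauge; case: ifPn => // _; exact: diam_ge0. Qed.

Let gauge0 delta : (0 < delta)%R -> gauge delta set0 = 0.
Proof. by move=> d0; rewrite /gauge diam0 lee_fin ltW. Qed.

Let hausdorff1_preE delta A : hausdorff1_pre delta A = mu_ext (gauge delta) A.
Proof.
apply/eqP; rewrite eq_le; apply/andP; split.
  apply: le_ereal_inf_tmp => _ [F [_ AF] <-].
  have [Fd|] := pselect (forall k, diam (F k) <= delta%:E).
    apply: ereal_inf_lbound; exists F => //.
    by apply: eq_eseriesr => k _; rewrite /gauge Fd.
  move=> /existsNP[k /negP Fk]; rewrite (@eseries_pinfty _ _ xpredT k) ?leey//.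
    by move=> j _; rewrite gt_eqF// (lt_le_trans _ (gauge_ge0 _ _)).
  by rewrite /gauge (negbTE Fk).
apply: le_ereal_inf_tmp => _ [F [Fd AF] <-].
apply: ereal_inf_lbound; exists F; last first.
  by apply: eq_eseriesr => k _; rewrite /gauge Fd.
by split => // k; exact: sub_sigma_algebra.
Qed.

Let hausdorff1_set0 : hausdorff1 set0 = 0.
Proof.
apply/eqP; rewrite eq_le; apply/andP; split.
  apply: ge_ereal_sup => _ [d d0 <-]; rewrite hausdorff1_preE mu_ext0//.
  exact: gauge0.
apply: ereal_sup_ubound; exists 1%R => //=.
by rewrite hausdorff1_preE mu_ext0//; exact: gauge0.
Qed.

Let hausdorff1_ge0 A : 0 <= hausdorff1 A.
Proof.
apply: (@le_trans _ _ (hausdorff1_pre 1 A)).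
  by rewrite hausdorff1_preE; exact: mu_ext_ge0.
by apply: ereal_sup_ubound; exists 1%R => //=.
Qed.

Let le_hausdorff1 : {homo hausdorff1 : A B / A `<=` B >-> A <= B}.
Proof.
move=> A B AB; apply: ge_ereal_sup => _ [d d0 <-].
apply: (@le_trans _ _ (hausdorff1_pre d B)).
  by rewrite !hausdorff1_preE; exact: le_mu_ext.
by apply: ereal_sup_ubound; exists d.
Qed.

Let hausdorff1_sigma_subadditive : sigma_subadditive hausdorff1.
Proof.
move=> F; apply: ge_ereal_sup => _ [d d0 <-]; rewrite hausdorff1_preE.
apply: (le_trans (mu_ext_sigma_subadditive (gauge_ge0 d) F)).
apply: lee_nneseries => k _; first by move=> _; exact: mu_ext_ge0.
by rewrite -hausdorff1_preE; apply: ereal_sup_ubound; exists d.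
Qed.

HB.instance Definition _ := isOuterMeasure.Build R 'rV[R]_n hausdorff1
  hausdorff1_set0 hausdorff1_ge0 le_hausdorff1 hausdorff1_sigma_subadditive.

Let mu : {outer_measure set 'rV[R]_n -> \bar R} := hausdorff1.

(* The measurable sets are those of Caratheodory, which include the Borel
   sets. *)
Definition hausdorff1_measure :
    {measure set (caratheodory_type mu) -> \bar R} :=
  mu : set (caratheodory_type mu) -> \bar R.

End Hausdorff.

Section Collision.
Context {R : realType}.

(* In a mode (s, k) the boolean s encodes the sign: true for +1, false for -1. *)
Definition mode : Type := (bool * 'rV[R]_2)%type.

Definition sgn (s : bool) : R := if s then 1 else -1.

(* A polar angle; it is determined up to a multiple of 2 pi for k != 0, and is
   used only through 2 pi-periodic functions. *)
Definition angle (k : 'rV[R]_2) : R :=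
  get [set t | k 0 0 = enorm k * cos t /\ k 0 1 = enorm k * sin t].

Definition japanese (k : 'rV[R]_2) : R := Num.sqrt (1 + enorm k ^+ 2).

Definition omega (a : mode) : R := sgn a.1 * (a.2 0 0 / enorm a.2).

Definition Gamma (a b c : mode) : R :=
  pi ^+ 2
  * (sgn a.1 * sin (angle a.2) + sgn b.1 * sin (angle b.2)
     + sgn c.1 * sin (angle c.2))
  * (sgn a.1 * enorm a.2 + sgn b.1 * enorm b.2 + sgn c.1 * enorm c.2).

Definition zero_frequency_cutoff (eps : R) (chi : R -> R) : Prop :=
  [/\ forall j t, derivable (derive1n j chi) t 1,
      forall t, chi (t + 2 * pi) = chi t,
      forall t, 0 <= chi t <= 1,
      forall t t', `|cos t| = `|cos t'| -> chi t = chi t' &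
      forall t, (`|cos t| < eps -> chi t = 0) /\
                (2 * eps < `|cos t| -> chi t = 1)].

(* A pair (k_beta, k_gamma) is the row vector row_mx k_beta k_gamma of R^4. *)
Definition resonance_map (a : mode) (sb sc : bool) (x : 'rV[R]_(2 + 2)) :
    'rV[R]_(1 + 2) :=
  row_mx (omega a + omega (sb, lsubmx x) + omega (sc, rsubmx x))%:M
         (a.2 + lsubmx x + rsubmx x).

Definition resonant_set (a : mode) (sb sc : bool) : set 'rV[R]_(2 + 2) :=
  [set x | [/\ lsubmx x != 0, rsubmx x != 0 & resonance_map a sb sc x = 0]].

(* The library jacobian acts on row vectors from the right, so it is the
   transpose of the usual Jacobian matrix D. *)
Definition coarea_factor (a : mode) (sb sc : bool) (x : 'rV[R]_(2 + 2)) : R :=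
  let D := (jacobian (resonance_map a sb sc) x)^T in
  Num.sqrt (\det (D *m D^T)).

Definition collision_integrand (chi : R -> R) (n : mode -> R) (a b c : mode) :
    R :=
  Gamma a b c ^+ 2 * omega a
  * (chi (angle a.2) * chi (angle b.2) * chi (angle c.2))
  * (omega a * n b * n c + omega c * n a * n b + omega b * n a * n c).

(* In \bar R the integral of a function is the difference of the integrals of
   its positive and negative parts, with +oo - +oo = -oo, and -oo absorbs in
   sums. Hence an infinite or undefined total is sent by fine to 0: only
   convergent collision integrals contribute a nonzero value. *)
Definition collision (chi : R -> R) (n : mode -> R) (a : mode) : R :=
  if a.2 == 0 then 0 else
  fine (\sum_(sb : bool) \sum_(sc : bool)
    \int[hausdorff1_measure]_(x in
        resonant_set a sb sc `&` [set x | (coarea_factor a sb sc x != 0)%R])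
      (collision_integrand chi n a (sb, lsubmx x) (sc, rsubmx x)
       / coarea_factor a sb sc x)%:E)%E.

Definition wnorm (m : R) (f : mode -> R) : \bar R :=
  ereal_sup (range (fun a : mode => (japanese a.2 `^ m * `|f a|)%:E)).

(* Borel measurability on {+1, -1} x R^2 is Borel measurability of the two
   slices. *)
Definition Linfty (m : R) : set (mode -> R) :=
  [set n : mode -> R |
    [/\ forall s : bool,
          measurable_fun [set: g_sigma_algebraType (@open 'rV[R]_2)]
            (fun k => n (s, k)),
        forall a, 0 <= n a &
        (wnorm m n < +oo)%E]].

(* C is not linear: bounded means sending norm-bounded sets to norm-bounded
   sets. *)
Definition bounded_map (m : R) (C : (mode -> R) -> mode -> R) : Prop :=
  forall r : R, exists K : R, forall n, Linfty m n ->
    (wnorm m n <= r%:E)%E -> (wnorm m (C n) <= K%:E)%E.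

End Collision.

Arguments mode : clear implicits.

(* Main.v *)
Require Import Defs.
From mathcomp Require Import all_boot all_order all_algebra.
From mathcomp Require Import all_classical all_reals all_analysis.
From mathcomp Require Import ring lra.

Set Implicit Arguments.
Unset Strict Implicit.
Unset Printing Implicit Defensive.

Import Order.TTheory GRing.Theory Num.Theory.
Import numFieldNormedType.Exports.

Local Open Scope classical_set_scope.
Local Open Scope ring_scope.

(** The operator fails to be bounded because of triads A + B + C = 0 in which A
    and B are very long, nearly opposite, and C has length of order one. With
    opposite signs the frequencies of A and B are nearly equal, so C has to
    carry about minus twice the frequency of A. If the cosine of A is exactly
    1/2, then C is forced to be nearly horizontal, and there the derivative of
    the frequency of C with respect to its angle vanishes. The constraint on
    frequencies degenerates, and the factor 1/J in the collision integral becomes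
    large.

    Quantitatively, let A have length [P^2]. The triads form an explicit curve
    parametrized by the defect [d] of order [P^-2] of the cosine of B below
    1/2; the sine of C is then of order [P^-1]. The coarea factor is the square
    root of 2 times the length of the difference of the frequency gradients
    ([coarea_factorE]), which along the curve is of order [P^-1]
    ([slope_gap], [slope_sum]), whereas the interaction coefficient stays
    bounded below ([Gamma_triad_ge1]) and the curve has length of order one
    ([hausdorff1_triad]).

    The density is the indicator of the C's for the sign + plus [P^(-2 m)]
    times the indicator of the B's for the sign -. Its weighted norm is bounded
    independently of [P] ([wnorm_density]). It vanishes at A, so that the
    integrand reduces to the product of the densities at B and C with
    nonnegative factors ([collision_integrandE]), and it is supported on the
    curve, up to exchange of the two integration variables ([support_triad]).
    The collision integral at A is thus finite and at least of order
    [P * P^(-2 m)]; the weight [P^(2 m)] at A leaves a quantity of order [P]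
    ([wnorm_collision_ge]).

    Three facts about the Hausdorff measure enter: closed sets are Caratheodory
    measurable, Lipschitz images of segments have finite measure, and a set
    whose projection to a coordinate axis contains an interval has measure at
    least half its length. *)

(** * One-dimensional Hausdorff measure *)

Section EuclideanNorm.
Context {R : realType} {n : nat}.
Implicit Types (x : 'rV[R]_n).

Lemma enorm_ge0 x : 0 <= enorm x.
Proof. exact: sqrtr_ge0. Qed.

Lemma coord_le_enorm x i : `|x 0 i| <= enorm x.
Proof.
rewrite -sqrtr_sqr ler_wsqrtr// (bigD1 i)//= lerDl.
by apply: sumr_ge0 => j _; rewrite sqr_ge0.
Qed.

Lemma norm_le_enorm x : `|x| <= enorm x.
Proof.
rewrite /Num.Def.normr/= mx_normrE; apply: bigmax_le; first exact: enorm_ge0.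
by move=> [i j] _ /=; rewrite (ord1 i) coord_le_enorm.
Qed.

Lemma enorm_le_sum x : enorm x <= \sum_(i < n) `|x 0 i|.
Proof.
have s0 : 0 <= \sum_(i < n) `|x 0 i| by apply: sumr_ge0.
rewrite -(ger0_norm s0) -sqrtr_sqr ler_wsqrtr// expr2 mulr_suml.
apply: ler_sum => i _; rewrite -real_normK ?num_real// expr2 ler_wpM2l//.
by rewrite (bigD1 i)//= lerDl; apply: sumr_ge0.
Qed.

End EuclideanNorm.

Section HausdorffMeasure.
Context {R : realType} {n : nat}.
Local Open Scope ereal_scope.
Implicit Types (A B X : set 'rV[R]_n).

Let H : {outer_measure set 'rV[R]_n -> \bar R} := @hausdorff1 R n.

Lemma enorm_le_diam A x y : A x -> A y -> (enorm (x - y))%:E <= diam A.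
Proof. by move=> Ax Ay; apply: ereal_sup_ubound; right; exists (x, y). Qed.

Lemma diam_le A (d : \bar R) : 0 <= d ->
  (forall x y, A x -> A y -> (enorm (x - y))%:E <= d) -> diam A <= d.
Proof.
by move=> d0 Ad; apply: ge_ereal_sup => _ [->//|[[x y] [Ax Ay] <-]]; exact: Ad.
Qed.

Lemma diam_subset A B : A `<=` B -> diam A <= diam B.
Proof.
move=> AB; apply: diam_le; first exact: diam_ge0.
by move=> x y /AB Bx /AB By; exact: enorm_le_diam.
Qed.

Lemma hausdorff1_pre_anti (d e : R) A : (d <= e)%R ->
  hausdorff1_pre e A <= hausdorff1_pre d A.
Proof.
move=> de; apply: ereal_inf_le_tmp => _ [F [Fd AF] <-].
by exists F => //; split => // k; rewrite (le_trans (Fd k))// lee_fin.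
Qed.

Lemma hausdorff1_pre_ge0 (d : R) A : 0 <= hausdorff1_pre d A.
Proof.
apply: le_ereal_inf_tmp => _ [F _ <-].
by apply: nneseries_ge0 => k _ _; exact: diam_ge0.
Qed.

(** The distance is taken in the sup norm: it is at most the Euclidean one, so a
    set of small diameter still meets only one of two separated sets. *)
Definition separated (e : R) A B := forall x y, A x -> B y -> (e <= `|x - y|)%R.

(** A set of diameter less than [e] meets at most one of two sets at distance
    at least [e], so a fine cover of the union splits into covers of the two
    parts without any set being counted twice. *)
Lemma hausdorff1_pre_separated (d e : R) A B : (d < e)%R -> separated e A B ->
  hausdorff1_pre d A + hausdorff1_pre d B <= hausdorff1_pre d (A `|` B).
Proof.
move=> de AB; apply: le_ereal_inf_tmp => _ [F [Fd ABF] <-].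
apply: (@le_trans _ _ (\sum_(k <oo) (diam (F k `&` A) + diam (F k `&` B)))).
  rewrite nneseriesD; [|by move=> *; exact: diam_ge0..].
  apply: leeD; apply: ereal_inf_lbound.
    exists (fun k => F k `&` A) => //; split.
      by move=> k; apply: le_trans (Fd k); apply: diam_subset; exact: subIsetl.
    move=> x Ax; have [k _ Fx] := ABF x (or_introl Ax).
    by exists k.
  exists (fun k => F k `&` B) => //; split.
    by move=> k; apply: le_trans (Fd k); apply: diam_subset; exact: subIsetl.
  move=> x Bx; have [k _ Fx] := ABF x (or_intror Bx).
  by exists k.
apply: lee_nneseries => k _.
  by move=> _; apply: adde_ge0; exact: diam_ge0.
have [FA|[x [Fx Ax]]] : F k `&` A = set0 \/ F k `&` A !=set0.
  have [/eqP|/set0P] := boolP (F k `&` A == set0); [by left|by right].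
  by rewrite FA diam0 add0e; apply: diam_subset; exact: subIsetl.
rewrite (_ : F k `&` B = set0) ?diam0 ?adde0.
  by apply: diam_subset; exact: subIsetl.
rewrite -subset0 => y [Fy By].
have := le_trans (enorm_le_diam Fx Fy) (Fd k).
rewrite lee_fin leNgt => /negP; apply.
by apply: (lt_le_trans de); apply: le_trans (norm_le_enorm _); exact: AB.
Qed.

Lemma hausdorff1_separated (e : R) A B : (0 < e)%R -> separated e A B ->
  H A + H B <= H (A `|` B).
Proof.
move=> e0 AB; have [HBy|HBy] := eqVneq (H B) +oo.
  apply: (@le_trans _ _ (H B)); first by rewrite HBy leey.
  by apply: le_outer_measure; exact: subsetUr.
have HBf : H B \is a fin_num by rewrite ge0_fin_numE ?outer_measure_ge0// ltey.
rewrite -leeBrDr//; apply: ge_ereal_sup => _ [d1 d10 <-].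
rewrite leeBrDr// addeC.
have HAf : hausdorff1_pre d1 A = +oo \/ hausdorff1_pre d1 A \is a fin_num.
  have [->|hA] := eqVneq (hausdorff1_pre d1 A) +oo; [by left|right].
  by rewrite ge0_fin_numE ?hausdorff1_pre_ge0// ltey.
have key d2 : (0 < d2)%R ->
    hausdorff1_pre d1 A + hausdorff1_pre d2 B <= H (A `|` B).
  move=> d20; pose d := (Num.min (Num.min d1 d2) (e / 2))%R.
  have d0 : (0 < d)%R by rewrite !lt_min d10 d20 divr_gt0.
  have dd1 : (d <= d1)%R by rewrite /d !ge_min lexx.
  have dd2 : (d <= d2)%R by rewrite /d !ge_min lexx orbT.
  have de : (d < e)%R by rewrite gt_min ltr_pdivrMr// mulrDr mulr1 ltrDl e0 orbT.
  apply: le_trans (leeD (hausdorff1_pre_anti A dd1) (hausdorff1_pre_anti B dd2)) _.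
  apply: le_trans (hausdorff1_pre_separated de AB) _.
  by apply: ereal_sup_ubound; exists d.
case: HAf => [hA|hA].
  have := key 1%R ltr01; rewrite hA addye ?leye_eq => [/eqP->|]; first exact: leey.
  by rewrite gt_eqF// (lt_le_trans _ (hausdorff1_pre_ge0 _ _)).
rewrite -leeBrDr//; apply: ge_ereal_sup => _ [d2 d20 <-].
by rewrite leeBrDr// addeC; exact: key.
Qed.

Let away A k : set 'rV[R]_n := [set x | forall y, A y -> (k.+1%:R^-1 <= `|x - y|)%R].
Let annulus A k := away A k.+1 `\` away A k.

Let annulus_separated A j k : (j.+1 < k)%N ->
  separated (j.+2%:R^-1 - j.+3%:R^-1) (annulus A j) (annulus A k).
Proof.
move=> jk x y [xj _] [_ /existsNP[z /not_implyP[Az /negP]]]; rewrite -ltNge => yz.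
have jk' : (k.+1%:R^-1 <= j.+3%:R^-1 :> R)%R.
  by rewrite lef_pV2 ?posrE// ler_nat.
have xz := xj z Az; have tri := ler_distD y x z.
rewrite lerBlDr; apply: le_trans xz _; apply: le_trans tri _; rewrite lerD2l.
exact: le_trans (ltW yz) jk'.
Qed.

Let parity_sum A X (b : bool) N :
  \sum_(k < N) H (X `&` annulus A (b + k.*2)%N) <=
  H (X `&` \big[setU/set0]_(k < N) annulus A (b + k.*2)%N).
Proof.
elim: N => [|N IH]; first by rewrite !big_ord0 setI0 outer_measure0.
rewrite !big_ord_recr/= setIUr; apply: le_trans (leeD IH (lexx _)) _.
case: N IH => [_|N IH].
  by rewrite big_ord0 setI0 outer_measure0 add0e set0U.
(* The gaps between consecutive radii decrease, so the gap at the last index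
   separates the new annulus from all the previous ones. *)
pose M := (b + N.*2)%N.
apply: (@hausdorff1_separated (M.+2%:R^-1 - M.+3%:R^-1)).
  by rewrite subr_gt0 ltf_pV2 ?posrE// ltr_nat.
move=> x y [_ ]; rewrite -(bigcup_mkord _ (fun k => annulus A (b + k.*2)%N)).
move=> -[k /= kN xk] [_ yN].
have kM : (b + k.*2 <= M)%N by rewrite leq_add2l leq_double -ltnS.
apply: le_trans (annulus_separated _ xk yN).
  rewrite -!natr1; set a : R := (b + k.*2)%:R; set c : R := M%:R.
  have ac : (a <= c)%R by rewrite ler_nat.
  have a0 : (0 <= a)%R by [].
  have E (z : R) : (0 <= z ->
      (z + 1 + 1)^-1 - (z + 1 + 1 + 1)^-1 = ((z + 2) * (z + 3))^-1)%R.
    by move=> z0; field; rewrite !gt_eqF//; lra.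
  rewrite !E//.
  by rewrite lef_pV2 ?posrE ?mulr_gt0 ?ltr_wpDl// ler_pM// ?addr_ge0// lerD2r.
by rewrite doubleS !addnS !ltnS.
Qed.

(** The Caratheodory criterion for metric outer measures. [X] minus [A] is
    approximated from inside by the points of [X] away from [A]; what is missed
    is covered by the tail of the annuli. Annuli whose indices have the same
    parity are separated, so the measures of all of them add up to at most
    twice the measure of [X], and the tail tends to 0. *)
Lemma closed_caratheodory A : closed A -> H.-caratheodory A.
Proof.
move=> cA; apply: le_caratheodory_measurable => X.
have [->|HXy] := eqVneq (H X) +oo; first exact: leey.
have HXf : H X \is a fin_num by rewrite ge0_fin_numE ?outer_measure_ge0// ltey.
pose Y k := H (X `&` annulus A k).
have Y0 k : 0 <= Y k by exact: outer_measure_ge0.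
have Ysum N : \sum_(0 <= k < N) Y k <= H X + H X.
  apply: (@le_trans _ _ (\sum_(0 <= k < N.*2) Y k)).
    rewrite (@big_cat_nat _ _ _ N _ N.*2)//= ?leeDl ?sume_ge0//.
    by rewrite -addnn leq_addr.
  rewrite (_ : \sum_(0 <= k < N.*2) Y k =
      \sum_(k < N) Y (0 + k.*2)%N + \sum_(k < N) Y (1 + k.*2)%N).
    apply: leeD.
      apply: le_trans (parity_sum A X false N) _.
      by apply: le_outer_measure; exact: subIsetl.
    apply: le_trans (parity_sum A X true N) _.
    by apply: le_outer_measure; exact: subIsetl.
  elim: N => [|N IH]; first by rewrite big_geq// !big_ord0 adde0.
  rewrite doubleS !big_nat_recr//= IH !big_ord_recr/= add1n add0n -!addeA; congr (_ + _).
  by rewrite addeCA.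
have Yser : \sum_(0 <= k <oo) Y k < +oo.
  apply: (@le_lt_trans _ _ (H X + H X)); last first.
    by rewrite ltey_eq fin_numD HXf.
  apply: lime_le; first by apply: is_cvg_nneseries.
  by apply: nearW => N.
have tail := nneseries_tail_cvg Yser (fun k _ => Y0 k).
have XA k : H (X `&` ~` A) <= H (X `&` away A k) + \sum_(k <= j <oo) Y j.
  apply: (@le_trans _ _ (H ((X `&` away A k) `|`
      \bigcup_(j in ~` `I_k) (X `&` annulus A j)))).
    apply: le_outer_measure => x [Xx Ax].
    have [m xm] : exists m, away A m x.
      have : open (~` A) by exact: closed_openC.
      rewrite openE => /(_ x Ax)/nbhs_ballP[e /= e0 xe].
      have [m _ me] := near_infty_natSinv_lt (PosNum e0).
      exists m => y Ay; rewrite leNgt; apply/negP => xy.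
      apply: (xe y) Ay; rewrite -ball_normE/=; apply: lt_trans xy _.
      exact: me (leqnn m).
    have [xk|xk] := pselect (away A k x); [by left|right].
    elim: m xm => [x0|m IH xm].
      exfalso; apply: xk => y /x0; apply: le_trans.
      by rewrite lef_pV2 ?posrE// ler_nat.
    have [xm'|xm'] := pselect (away A m x); first exact: IH.
    exists m => //=; apply/negP; rewrite -leqNgt leqNgt; apply/negP => mk.
    apply: xk => y /xm; apply: le_trans.
    by rewrite lef_pV2 ?posrE// ler_nat.
  apply: le_trans (outer_measureU2 _ _ _) _.
  by rewrite leeD2l//; exact: outer_measure_sigma_subadditive_tail.
have bound k : H (X `&` A) + H (X `&` ~` A) <= H X + \sum_(k <= j <oo) Y j.
  apply: le_trans (leeD2l _ (XA k)) _; rewrite addeA leeD2r//.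
  apply: (@le_trans _ _ (H ((X `&` A) `|` (X `&` away A k)))).
    apply: (@hausdorff1_separated (k.+1%:R^-1)) => //.
    by move=> x y [_ Ax] [_ /(_ _ Ax)]; rewrite distrC.
  by apply: le_outer_measure => x [] [].
have lim : (fun k => (H X + \sum_(k <= j <oo) Y j)%E) @ \oo --> (H X + 0)%E.
  by apply: cvgeD; [rewrite fin_num_adde_defr|exact: cvg_cst|].
rewrite -[leRHS]adde0 -(cvg_lim _ lim)//; apply: lime_ge.
  by apply/cvg_ex; exists (H X + 0).
exact: nearW.
Qed.

(** The segment is cut into [N + 1] pieces whose images have diameter at most
    [d]. *)
Lemma hausdorff1_lipschitz_image (gamma : R -> 'rV[R]_n) (a b L : R) :
  (a <= b)%R -> (0 <= L)%R ->
  (forall s t, a <= s <= b -> a <= t <= b ->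
    enorm (gamma s - gamma t) <= L * `|s - t|)%R ->
  H (gamma @` `[a, b]%classic) <= (L * (b - a))%:E.
Proof.
move=> ab L0 lip; apply: ge_ereal_sup => _ [d /= d0 <-].
have [N Nd] : exists N, (L * (b - a) / N.+1%:R <= d)%R.
  have LB : (0 <= L * (b - a))%R by rewrite mulr_ge0// subr_ge0.
  have [N _ NN] := near_infty_natSinv_lt (PosNum (divr_gt0 d0 (ltr_pwDr ltr01 LB))).
  exists N; have := ltW (NN N (leqnn _)); rewrite /= => h.
  apply: le_trans (ler_wpM2l LB h) _.
  by rewrite mulrCA ger_pMr// ler_pdivrMr ?mul1r ?lerDl// ltr_pwDr.
pose t k : R := (a + (b - a) * (k%:R / N.+1%:R))%R.
have ba : (0 <= b - a)%R by rewrite subr_ge0.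
have tmono j k : (j <= k)%N -> (t j <= t k)%R.
  by move=> jk; rewrite lerD2l ler_wpM2l// ler_wpM2r ?invr_ge0// ler_nat.
have t0 : t 0%N = a by rewrite /t mul0r mulr0 addr0.
have tN : t N.+1 = b by rewrite /t divff// mulr1 addrC subrK.
have tS k : (t k.+1 - t k = (b - a) / N.+1%:R)%R.
  by rewrite /t -natr1; ring.
have tab k : (k <= N.+1)%N -> (a <= t k <= b)%R.
  by move=> kN; rewrite -t0 -tN !tmono.
pose F k := if (k <= N)%N then gamma @` `[t k, t k.+1]%classic else set0.
have Fd k : diam (F k) <= if (k <= N)%N then (L * (b - a) / N.+1%:R)%:E else 0.
  rewrite /F; case: ifPn => kN; last by rewrite diam0.
  apply: diam_le; first by rewrite lee_fin divr_ge0// mulr_ge0.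
  move=> _ _ [u /= /[!in_itv]/= /andP[tu ut] <-] [v /= /[!in_itv]/= /andP[tv vt] <-].
  have /andP[ak _] := tab k (leqW kN); have /andP[_ kb] := tab k.+1 kN.
  rewrite lee_fin; apply: le_trans (lip _ _ _ _) _.
  - by rewrite (le_trans ak)//= (le_trans _ kb).
  - by rewrite (le_trans ak)//= (le_trans _ kb).
  rewrite -mulrA ler_wpM2l// -(tS k) ler_distl; apply/andP; split; lra.
apply: (@ge_ereal_inf _ _ _ ).
exists (\sum_(k <oo) diam (F k)).
  exists F => //; split.
    move=> k; apply: le_trans (Fd k) _; case: ifP => _; rewrite lee_fin//.
    exact: ltW.
  move=> _ [u /= /[!in_itv]/= /andP[au ub] <-].
  have /(_ N (leqnn N)) : forall k, (k <= N)%N -> (u <= t k.+1)%R ->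
      exists2 k, (k <= N)%N & (t k <= u <= t k.+1)%R.
    elim=> [_ ut|k IH kN ut]; first by exists 0%N => //; rewrite t0 au ut.
    have [utk|tku] := leP u (t k.+1); first by apply: IH => //; exact: ltnW.
    by exists k.+1 => //; rewrite (ltW tku) ut.
  rewrite tN => /(_ ub)[k kN tku]; exists k => //; rewrite /F kN.
  by exists u => //=; rewrite in_itv.
apply: (@le_trans _ _
  (\sum_(k <oo) if (k <= N)%N then (L * (b - a) / N.+1%:R)%:E else 0)).
  by apply: lee_nneseries => k _ //; move=> _; exact: diam_ge0.
rewrite (nneseries_split _ N.+1); last first.
  by move=> k _; case: ifP => _; rewrite lee_fin// divr_ge0// mulr_ge0.
rewrite [X in _ + X]eseries0 ?adde0; last first.
  by move=> k; rewrite add0n ltnNge => /negbTE ->.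
rewrite add0n big_mkord (eq_bigr (fun=> (L * (b - a) / N.+1%:R)%:E)); last first.
  by move=> k _; rewrite -ltnS ltn_ord.
rewrite sumEFin lee_fin sumr_const card_ord.
by rewrite -(mulr_natr (L * (b - a) / N.+1%:R)) divfK.
Qed.

(** A set of diameter [d] projects into an interval of length [2 d] centred at
    the projection of any of its points, and these intervals must cover
    [[a, b]]. The factor 2 saves the choice of an optimal interval. *)
Lemma hausdorff1_projection A (i : 'I_n) (a b : R) : (a <= b)%R ->
  (forall u, a <= u <= b -> exists2 x : 'rV[R]_n, A x & x 0 i = u)%R ->
  ((b - a) / 2)%:E <= H A.
Proof.
move=> ab Aab; apply: (@le_trans _ _ (hausdorff1_pre 1 A)); last first.
  by apply: ereal_sup_ubound; exists 1%R => /=.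
apply: le_ereal_inf_tmp => _ [F [Fd AF] <-].
have Ffin k : diam (F k) \is a fin_num.
  by rewrite ge0_fin_numE ?diam_ge0// (le_lt_trans (Fd k)) ?ltry.
have I k : {I : set R | measurable I /\
    (forall x, F k x -> I (x 0%R i)) /\ lebesgue_measure I <= 2%:E * diam (F k)}.
  apply: cid; have [/eqP F0|/set0P[y Fy]] := boolP (F k == set0).
    exists set0; split=> //; split; first by rewrite F0.
    by rewrite measure0 mule_ge0// diam_ge0.
  exists `[(y 0 i - fine (diam (F k)))%R, (y 0 i + fine (diam (F k)))%R]%classic.
  split=> //; split.
    move=> x Fx /=; rewrite in_itv/= -ler_distl -lee_fin fineK//.
    apply: le_trans (enorm_le_diam Fx Fy); rewrite lee_fin.
    by have := coord_le_enorm (x - y) i; rewrite !mxE.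
  rewrite lebesgue_measure_itv/= lte_fin; case: ifPn => _; last first.
    by rewrite mule_ge0// diam_ge0.
  by rewrite -(fineK (Ffin k)) -EFinB -EFinM lee_fin/=; lra.
pose J k := sval (I k).
have mJ k : measurable (J k) by case: (svalP (I k)).
have FJ k x : F k x -> J k (x 0%R i) by case: (svalP (I k)) => _ [+ _]; exact.
have lJ k : lebesgue_measure (J k) <= 2%:E * diam (F k) by case: (svalP (I k)) => _ [].
suff S2 : (b - a)%:E <= 2%:E * \sum_(k <oo) diam (F k).
  have /(lee_wpmul2l (x := (2^-1)%:E)) := S2.
  by rewrite lee_fin invr_ge0 ler0n muleA -!EFinM mulVf// mul1e mulrC; exact.
rewrite -nneseriesZl//; last by move=> k _; exact: diam_ge0.
have -> : (b - a)%:E = lebesgue_measure `[a, b]%classic.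
  rewrite lebesgue_measure_itv/= lte_fin; case: ltP => // ba.
  by have -> : a = b; [apply/eqP; rewrite eq_le ab|rewrite subrr].
apply: (@le_trans _ _ (\sum_(k <oo) lebesgue_measure (J k))).
  apply: (measure_sigma_subadditive lebesgue_measure) => //.
  move=> u /= /[!in_itv]/= /Aab[x Ax <-]; have [k _ Fx] := AF x Ax.
  by exists k => //; exact: FJ.
by apply: lee_nneseries.
Qed.

End HausdorffMeasure.

(** * Integrals of nonnegative functions *)

Section IntegralBounds.
Context d (T : measurableType d) (R : realType).
Variable mu : {measure set T -> \bar R}.
Local Open Scope ereal_scope.
Import HBNNSimple.

Let indicZ (E : set T) (mE : measurable E) (c : R) (c0 : (0 <= c)%R) :
    {nnsfun T >-> R} :=
  scale_nnsfun (indic_nnsfun R mE) c0.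

Let sintegral_indicZ E mE c c0 : sintegral mu (@indicZ E mE c c0) = c%:E * mu E.
Proof. by rewrite -(sintegral_indic mu E) -(sintegralrM mu c (indic_nnsfun R mE)). Qed.

(** The integral of a nonnegative function is a supremum over the simple
    functions below it, so it can be compared with a multiple of an indicator
    even when the function is not known to be measurable. *)
Lemma integral_ge_indic (D E : set T) (f : T -> R) (c : R) :
  measurable E -> E `<=` D -> (0 <= c)%R ->
  (forall x, D x -> 0 <= f x)%R -> (forall x, E x -> c <= f x)%R ->
  c%:E * mu E <= \int[mu]_(x in D) (f x)%:E.
Proof.
move=> mE ED c0 f0 cf.
rewrite ge0_integralE => [|x Dx]; last by rewrite lee_fin f0.
apply: ereal_sup_ubound; exists (indicZ mE c0); last exact: sintegral_indicZ.
move=> x /=; rewrite patchE.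
have [xE|xE] := boolP (x \in E).
  have Ex : E x by rewrite inE in xE.
  rewrite mem_set; last exact: ED.
  by rewrite lee_fin measurable_realfun.mindicE xE mulr1 cf.
rewrite measurable_realfun.mindicE (negbTE xE) mulr0; case: ifPn => //; rewrite inE => Dx.
by rewrite lee_fin f0.
Qed.

Lemma integral_le_indic (D E : set T) (f : T -> R) (c : R) :
  measurable E -> (0 <= c)%R ->
  (forall x, D x -> 0 <= f x)%R -> (forall x, D x -> E x -> f x <= c)%R ->
  (forall x, D x -> ~ E x -> f x = 0)%R ->
  \int[mu]_(x in D) (f x)%:E <= c%:E * mu E.
Proof.
move=> mE c0 f0 fc fE.
rewrite ge0_integralE => [|x Dx]; last by rewrite lee_fin f0.
apply: ge_ereal_sup => _ [h hf <-].
rewrite -(sintegral_indicZ mE c0); apply: le_sintegral => x.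
rewrite -lee_fin; apply: le_trans (hf x) _; rewrite patchE/= measurable_realfun.mindicE.
case: ifPn => [|_]; last by rewrite lee_fin mulr_ge0.
rewrite inE => Dx; have [xE|xE] := boolP (x \in E).
  by rewrite mulr1 lee_fin fc//; rewrite inE in xE.
by rewrite mulr0 lee_fin fE//; rewrite notin_setE in xE.
Qed.

End IntegralBounds.

(** * Frequencies, angles and the coarea factor *)

Section Plane.
Context {R : realType}.
Implicit Types (k : 'rV[R]_2).

Lemma ord2P (i : 'I_2) : i = 0 \/ i = 1.
Proof. by case: i => [[|[|//]]] ?; [left|right]; apply: val_inj. Qed.

Lemma big_ord2 (V : nmodType) (F : 'I_2 -> V) : \sum_(i < 2) F i = F 0 + F 1.
Proof.
by rewrite !big_ord_recl big_ord0 addr0; congr (F _ + F _); apply: val_inj.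
Qed.

Lemma enorm2E k : enorm k = Num.sqrt (k 0 0 ^+ 2 + k 0 1 ^+ 2).
Proof. by rewrite /enorm big_ord2. Qed.

Lemma enorm2_sq k : enorm k ^+ 2 = k 0 0 ^+ 2 + k 0 1 ^+ 2.
Proof. by rewrite enorm2E sqr_sqrtr// addr_ge0 ?sqr_ge0. Qed.

Lemma rV2P k k' : k 0 0 = k' 0 0 -> k 0 1 = k' 0 1 -> k = k'.
Proof. by move=> e0 e1; apply/rowP => i; case: (ord2P i) => ->. Qed.

Lemma sq_gt0 k : k != 0 -> 0 < k 0 0 ^+ 2 + k 0 1 ^+ 2.
Proof.
move=> k0; rewrite lt_neqAle addr_ge0 ?sqr_ge0// andbT eq_sym paddr_eq0 ?sqr_ge0//.
apply: contra k0; rewrite !sqrf_eq0 => /andP[/eqP a /eqP b].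
by apply/eqP/rV2P; rewrite mxE.
Qed.

Lemma enorm2_gt0 k : k != 0 -> 0 < enorm k.
Proof. by move=> k0; rewrite enorm2E sqrtr_gt0 sq_gt0. Qed.

Lemma is_diff_coord m n (M : 'M[R]_(m, n)) i j :
  is_diff M (fun N : 'M[R]_(m, n) => N i j : R) (fun N => N i j).
Proof.
apply: DiffDef; first exact: differentiable_coord.
have @f : {linear 'M[R]_(m, n) -> R}.
  by exists (fun N : 'M[R]_(_, _) => N i j); do 2![eexists]; do ?[constructor];
     rewrite ?mxE// => ? *; rewrite ?mxE//; move=> ?; rewrite !mxE.
by rewrite (_ : (fun _ => _) = f)// diff_lin//; exact: coord_continuous.
Qed.

Lemma is_diff_sqrt (u : R) : 0 < u ->
  is_diff u Num.sqrt (fun h => h / (2 * Num.sqrt u)).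
Proof.
move=> u0; have [du ud] := is_derive1_sqrt u0; apply: DiffDef.
  exact/derivable1_diffP.
rewrite deriv1E// derive1E ud; exact/funext.
Qed.

Definition dircos k : R := k 0 0 / enorm k.

Definition grad_dircos k : 'rV[R]_2 :=
  (k 0 1 / enorm k ^+ 3) *: (\row_i (if i == 0 then k 0 1 else - k 0 0)).

Lemma is_diff_dircos k : k != 0 ->
  is_diff k dircos (fun h => \sum_i h 0 i * grad_dircos k 0 i).
Proof.
move=> k0; have r0 := enorm2_gt0 k0; have s0 := sq_gt0 k0.
have dx := is_diff_coord k 0 0; have dy := is_diff_coord k 0 1.
pose x (k : 'rV[R]_2) := k 0 0; pose y (k : 'rV[R]_2) := k 0 1.
have ds := is_diffD (is_diffX 1 dx) (is_diffX 1 dy).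
have dr : is_diff k (@enorm R 2) (fun h => (h 0 0 * k 0 0 + h 0 1 * k 0 1) / enorm k).
  have -> : @enorm R 2 = Num.sqrt \o (x ^+ 2 + y ^+ 2).
    by apply/funext => h; rewrite enorm2E.
  apply: is_diff_eq; first exact: (is_diff_comp ds (is_diff_sqrt s0)).
  apply/funext => h; rewrite /= -enorm2E /x /y !fctE/= !expr1.
  rewrite /GRing.scale/=; field; exact: lt0r_neq0.
have dv : is_diff k (GRing.inv \o @enorm R 2)
    (fun h => - ((h 0 0 * k 0 0 + h 0 1 * k 0 1) / enorm k) / enorm k ^+ 2).
  apply: DiffDef.
    by apply: differentiableV; [case: dr|exact: lt0r_neq0].
  rewrite (diffV (f := @enorm R 2)); [|by case: dr|exact: lt0r_neq0].
  apply/funext => h; rewrite diff_val -[LHS]/(_ * _).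
  by field; exact: lt0r_neq0.
have -> : dircos = x * (GRing.inv \o @enorm R 2) by exact/funext.
apply: (is_diff_eq (is_diffM dx dv)).
apply/funext => h; rewrite big_ord2 !mxE/=.
rewrite -[LHS]/(k 0 0 * (- ((h 0 0 * k 0 0 + h 0 1 * k 0 1) / enorm k)
  / enorm k ^+ 2) + (enorm k)^-1 * h 0 0).
transitivity ((enorm k ^+ 2 * h 0 0
  - k 0 0 * (h 0 0 * k 0 0 + h 0 1 * k 0 1)) / enorm k ^+ 3).
  by field; exact: lt0r_neq0.
by rewrite enorm2_sq; ring.
Qed.

Lemma angleE k : k != 0 ->
  cos (angle k) = k 0 0 / enorm k /\ sin (angle k) = k 0 1 / enorm k.
Proof.
move=> k0; have r0 := enorm2_gt0 k0; have rE := enorm2_sq k.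
suff [t tk] : [set t | k 0 0 = enorm k * cos t /\ k 0 1 = enorm k * sin t] !=set0.
  have /= [{2}-> {2}->] := getPex (ex_intro _ t tk).
  by rewrite -/(angle k) ![enorm k * _]mulrC !mulfK ?lt0r_neq0.
have h1 : -1 <= k 0 0 / enorm k <= 1.
  rewrite -ler_norml normrM normfV (gtr0_norm r0) ler_pdivrMr// mul1r.
  exact: coord_le_enorm.
have hs : Num.sqrt (1 - (k 0 0 / enorm k) ^+ 2) = `|k 0 1| / enorm k.
  have -> : 1 - (k 0 0 / enorm k) ^+ 2 = (k 0 1 / enorm k) ^+ 2.
    rewrite !expr_div_n rE.
    by field; rewrite -rE lt0r_neq0// exprn_gt0.
  by rewrite sqrtr_sqr normrM normfV (gtr0_norm r0).
have [k1|k1] := leP 0 (k 0 1).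
  exists (acos (k 0 0 / enorm k)); rewrite /= acosK ?in_itv// sin_acos// hs.
  by rewrite (ger0_norm k1) ![enorm k * _]mulrC !divfK ?lt0r_neq0.
exists (- acos (k 0 0 / enorm k)); rewrite /= cosN sinN acosK ?in_itv// sin_acos// hs.
by rewrite (ltr0_norm k1) mulNr opprK ![enorm k * _]mulrC !divfK ?lt0r_neq0.
Qed.

(** A map into row vectors is the sum of its coordinates times the basis
    vectors. *)
Lemma is_diff_rV m n (f : 'rV[R]_m -> 'rV[R]_n) (df : 'I_n -> 'rV[R]_m -> R) x :
  (forall j, is_diff x (fun y => f y 0 j) (df j)) ->
  is_diff x f (fun h => \row_j df j h).
Proof.
move=> fd; have fE : f = \sum_(j < n) (fun y => f y 0 j *: delta_mx 0 j).
  by apply/funext => y; rewrite fct_sumE [LHS]row_sum_delta.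
have df_ : differentiable f x.
  rewrite fE; apply: differentiable_sum => j; apply: differentiableZl.
  by case: (fd j).
apply: is_diff_eq (differentiableP df_) _.
apply/funext => h; apply/rowP => j; rewrite mxE.
have [_ <-] := fd j.
have [dc dcE] := is_diff_coord (f x) 0 j.
have -> : (fun y => f y 0 j) = (fun N : 'rV[R]_n => N 0 j) \o f by [].
by rewrite (diff_comp df_ dc) dcE.
Qed.

Lemma is_diff_lsubmx m n1 n2 (x : 'M[R]_(m, n1 + n2)) : is_diff x lsubmx lsubmx.
Proof.
apply: DiffDef; first exact: differentiable_lsubmx.
by rewrite diff_lin//; exact: continuous_lsubmx.
Qed.

Lemma is_diff_rsubmx m n1 n2 (x : 'M[R]_(m, n1 + n2)) : is_diff x rsubmx rsubmx.
Proof.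
apply: DiffDef; first exact: differentiable_rsubmx.
by rewrite diff_lin//; exact: continuous_rsubmx.
Qed.

Lemma jacobian_resonance_map (a : mode R) sb sc x :
  lsubmx x != 0 -> rsubmx x != 0 ->
  jacobian (resonance_map a sb sc) x =
  block_mx (sgn sb *: grad_dircos (lsubmx x))^T 1%:M
           (sgn sc *: grad_dircos (rsubmx x))^T 1%:M.
Proof.
move=> b0 c0.
pose df (j : 'I_(1 + 2)) (h : 'rV[R]_(2 + 2)) : R :=
  match fintype.split j with
  | inl _ => sgn sb * (\sum_i lsubmx h 0 i * grad_dircos (lsubmx x) 0 i) +
             sgn sc * (\sum_i rsubmx h 0 i * grad_dircos (rsubmx x) 0 i)
  | inr j => h 0 (lshift 2 j) + h 0 (rshift 2 j)
  end.
have D : is_diff x (resonance_map a sb sc) (fun h => \row_j df j h).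
  apply: is_diff_rV => j; rewrite /df; case: splitP => j' jj.
    have -> : (fun y => resonance_map a sb sc y 0 j) =
        cst (omega a) + sgn sb *: (dircos \o lsubmx) + sgn sc *: (dircos \o rsubmx).
      apply/funext => y; have -> : j = lshift 2 j' by exact: val_inj.
      by rewrite row_mxEl mxE (ord1 j') eqxx mulr1n.
    have dl := is_diff_comp (is_diff_lsubmx x) (is_diff_dircos b0).
    have dr := is_diff_comp (is_diff_rsubmx x) (is_diff_dircos c0).
    apply: (is_diff_eq (is_diffD (is_diffD (is_diff_cst (omega a) x)
      (is_diffZ (sgn sb) dl)) (is_diffZ (sgn sc) dr))).
    by apply/funext => h; rewrite -[LHS]/(0 + _ + _) add0r.
  have -> : (fun y => resonance_map a sb sc y 0 j) =
      cst (a.2 0 j') + (fun y => y 0 (lshift 2 j')) + (fun y => y 0 (rshift 2 j')).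
    apply/funext => y; have -> : j = rshift 1 j' by exact: val_inj.
    by rewrite row_mxEr !mxE.
  have dl := is_diff_coord x 0 (lshift 2 j'); have dr := is_diff_coord x 0 (rshift 2 j').
  apply: (is_diff_eq (is_diffD (is_diffD (is_diff_cst (a.2 0 j') x) dl) dr)).
  by apply/funext => h; rewrite -[LHS]/(0 + _ + _) add0r.
have deltaE (i : 'I_2) (A : 'rV[R]_2) :
    \sum_(l < 2) (i == l)%:R * A 0 l = A 0 i.
  rewrite (bigD1 i)//= eqxx mul1r big1 ?addr0// => l li.
  by rewrite eq_sym (negbTE li) mul0r.
have lsubE (i : 'I_(2 + 2)) (l : 'I_2) :
    lsubmx (delta_mx 0 i : 'rV[R]_(2 + 2)) 0 l = (i == lshift 2 l)%:R.
  by rewrite mxE mxE eqxx eq_sym.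
have rsubE (i : 'I_(2 + 2)) (l : 'I_2) :
    rsubmx (delta_mx 0 i : 'rV[R]_(2 + 2)) 0 l = (i == rshift 2 l)%:R.
  by rewrite mxE mxE eqxx eq_sym.
rewrite /jacobian; apply/matrixP => i j; rewrite mxE/= diff_val mxE /df.
under eq_bigr do rewrite lsubE; under [X in _ + sgn sc * X]eq_bigr do rewrite rsubE.
case: (split_ordP i) => i' ->; case: (split_ordP j) => j' ->.
- rewrite block_mxEul [RHS]mxE [RHS]mxE (ord1 j').
  under eq_bigr do rewrite eq_lshift.
  under [X in _ + sgn sc * X]eq_bigr do rewrite eq_lrshift.
  by rewrite deltaE [X in sgn sc * X]big1 ?mulr0 ?addr0// => l _; rewrite mul0r.
- rewrite block_mxEur !mxE !eqxx/= eq_sym eq_lshift eq_rlshift addr0.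
  by rewrite eq_sym.
- rewrite block_mxEdl [RHS]mxE [RHS]mxE (ord1 j').
  under eq_bigr do rewrite eq_rlshift.
  under [X in _ + sgn sc * X]eq_bigr do rewrite eq_rshift.
  by rewrite deltaE [X in sgn sb * X]big1 ?mulr0 ?add0r// => l _; rewrite mul0r.
- rewrite block_mxEdr !mxE !eqxx/= eq_lrshift eq_rshift add0r.
  by rewrite eq_sym.
Qed.

(** With [u] and [v] the signed gradients of the two frequencies, the Gram
    matrix of the constraints is [[|u|^2 + |v|^2, u + v], [u + v, 2 I]]; its
    Schur complement turns the determinant into
    [4 (|u|^2 + |v|^2 - |u + v|^2 / 2) = 2 |u - v|^2]. *)
Lemma coarea_factorE (a : mode R) sb sc x : lsubmx x != 0 -> rsubmx x != 0 ->
  coarea_factor a sb sc x =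
  Num.sqrt 2 *
  enorm (sgn sb *: grad_dircos (lsubmx x) - sgn sc *: grad_dircos (rsubmx x)).
Proof.
move=> b0 c0; rewrite /coarea_factor jacobian_resonance_map// trmxK.
set u := sgn sb *: _; set v := sgn sc *: _.
rewrite tr_block_mx !trmxK !trmx1 mulmx_block !mulmx1 !mul1mx.
pose w : 'rV[R]_2 := u + v; pose M : 'M[R]_1 := u *m u^T + v *m v^T - w *m (2^-1 *: w^T).
rewrite (_ : block_mx _ _ _ _ =
  block_mx 1%:M (2^-1 *: w) 0 1%:M *m block_mx M 0 w^T (2%:M : 'M[R]_2)); last first.
  rewrite mulmx_block !mul0mx !mul1mx !add0r; congr block_mx.
  - by rewrite /M -scalemxAl -scalemxAr subrK.
  - by rewrite -scalemxAl mul_mx_scalar scalerA mulVf ?scale1r.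
  - by rewrite /w linearD.
  - by rewrite -raddfD.
rewrite det_mulmx det_ublock det_lblock !det1 !mul1r det_scalar det_mx11.
rewrite enorm2E -sqrtrM//; congr Num.sqrt.
rewrite /M /w !mxE !big_ord2 !mxE; field.
by rewrite !lt0r_neq0 ?enorm2_gt0.
Qed.

Lemma normr_sgnM s (y : R) : `|sgn s * y| = `|y|.
Proof. by rewrite normrM; case: s; rewrite /sgn ?normrN normr1 mul1r. Qed.

Lemma grad_dircos_le k i : k != 0 ->
  `|grad_dircos k 0 i| <= `|k 0 1| / enorm k ^+ 2.
Proof.
move=> k0; have r0 := enorm2_gt0 k0.
rewrite !mxE/= !normrM normfV (gtr0_norm (exprn_gt0 3 r0)).
rewrite -mulrA ler_wpM2l//; apply: (@le_trans _ _ ((enorm k ^+ 3)^-1 * enorm k)).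
  rewrite ler_wpM2l ?invr_ge0 ?exprn_ge0 ?enorm_ge0//.
  by case: ifP; rewrite ?normrN coord_le_enorm.
suff -> : (enorm k ^+ 3)^-1 * enorm k = (enorm k ^+ 2)^-1 by [].
by field; exact: lt0r_neq0.
Qed.

Lemma coarea_factor_le (a : mode R) sb sc x : lsubmx x != 0 -> rsubmx x != 0 ->
  coarea_factor a sb sc x <=
  3 * (`|lsubmx x 0 1| / enorm (lsubmx x) ^+ 2 +
       `|rsubmx x 0 1| / enorm (rsubmx x) ^+ 2).
Proof.
move=> b0 c0; rewrite coarea_factorE//; set B := _ / _; set C := _ / _; set g := _ - _.
have sqrt2 : Num.sqrt 2 <= 3 / 2 :> R.
  by rewrite -(ler_pXn2r (n := 2)) ?nnegrE ?sqrtr_ge0// sqr_sqrtr//; lra.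
have gBC i : `|g 0 i| <= B + C.
  have -> : g 0 i = sgn sb * grad_dircos (lsubmx x) 0 i
    - sgn sc * grad_dircos (rsubmx x) 0 i by rewrite !mxE.
  apply: le_trans (ler_normB _ _) _; rewrite !normr_sgnM.
  by apply: lerD; exact: grad_dircos_le.
have g2 : enorm g <= (B + C) * 2.
  by apply: le_trans (enorm_le_sum _) _; rewrite big_ord2 mulr_natr mulr2n lerD.
apply: le_trans (ler_pM _ _ sqrt2 g2) _; rewrite ?sqrtr_ge0 ?enorm_ge0//; lra.
Qed.

(** The second coordinates of the two gradients are enough to see that they
    differ, and the bound does not depend on the signs. *)
Lemma coarea_factor_ge (a : mode R) sb sc x : lsubmx x != 0 -> rsubmx x != 0 ->
  `| `|grad_dircos (lsubmx x) 0 1| - `|grad_dircos (rsubmx x) 0 1| |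
    <= coarea_factor a sb sc x.
Proof.
move=> b0 c0; rewrite coarea_factorE//; set g := (X in enorm X).
have gE : g 0 1 = sgn sb * grad_dircos (lsubmx x) 0 1
    - sgn sc * grad_dircos (rsubmx x) 0 1 by rewrite !mxE.
rewrite -(normr_sgnM sb (grad_dircos _ 0 1)).
rewrite -(normr_sgnM sc (grad_dircos (rsubmx x) 0 1)).
apply: le_trans (ler_dist_dist _ _) _; rewrite -gE.
apply: le_trans (coord_le_enorm g 1) _; rewrite ler_peMl ?enorm_ge0//.
rewrite -(ler_pXn2r (n := 2)) ?nnegrE ?sqrtr_ge0//.
by rewrite sqr_sqrtr// expr1n; lra.
Qed.

End Plane.

(** * Lipschitz functions on a segment *)

Section Lipschitz.
Context {R : realType}.
Variables a b : R.
Implicit Types f g : R -> R.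

(** The constant is existential so that the closure properties below apply to
    composite expressions without tracking it. *)
Definition lip f := exists2 L : R, 0 <= L &
  forall s t, a <= s <= b -> a <= t <= b -> `|f s - f t| <= L * `|s - t|.

Lemma lip_bounded f : lip f ->
  exists2 M, 0 <= M & forall t, a <= t <= b -> `|f t| <= M.
Proof.
move=> [L L0 Lf]; have [ab|ba] := leP a b; last first.
  exists 0 => // t /andP[at_ tb]; have := le_trans at_ tb.
  by rewrite leNgt ba.
exists (`|f a| + L * (b - a)); first by rewrite addr_ge0// mulr_ge0// subr_ge0.
move=> t /andP[at_ tb]; rewrite -[f t](subrK (f a)) addrC.
apply: le_trans (ler_normD _ _) _; rewrite lerD2l.
apply: le_trans (Lf t a _ _) _; rewrite ?lexx ?at_ ?tb//.
by rewrite ler_wpM2l// ger0_norm ?subr_ge0// lerD2r.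
Qed.

Lemma lip_cst c : lip (cst c).
Proof. by exists 0 => // s t _ _; rewrite subrr normr0 mul0r. Qed.

Lemma lip_id : lip id.
Proof. by exists 1 => // s t _ _; rewrite mul1r. Qed.

Lemma lipD f g : lip f -> lip g -> lip (fun t => f t + g t).
Proof.
move=> [L L0 Lf] [M M0 Mg]; exists (L + M); first exact: addr_ge0.
move=> s t sab tab; rewrite opprD addrACA mulrDl.
by apply: le_trans (ler_normD _ _) _; rewrite lerD ?Lf ?Mg.
Qed.

Lemma lipN f : lip f -> lip (fun t => - f t).
Proof.
move=> [L L0 Lf]; exists L => // s t sab tab.
by rewrite -opprD normrN Lf.
Qed.

Lemma lipB f g : lip f -> lip g -> lip (fun t => f t - g t).
Proof. by move=> lf lg; apply: lipD => //; exact: lipN. Qed.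

Lemma lipM f g : lip f -> lip g -> lip (fun t => f t * g t).
Proof.
move=> lf lg; have [F F0 Ff] := lip_bounded lf; have [G G0 Gg] := lip_bounded lg.
case: lf lg => [L L0 Lf] [M M0 Mg].
exists (F * M + G * L); first by rewrite addr_ge0 ?mulr_ge0.
move=> s t sab tab.
have -> : f s * g s - f t * g t = f s * (g s - g t) + g t * (f s - f t) by ring.
apply: le_trans (ler_normD _ _) _; rewrite !normrM mulrDl -!mulrA lerD// ler_pM//.
- exact: Ff.
- exact: Mg.
- exact: Gg.
- exact: Lf.
Qed.

Lemma lipV f c : 0 < c -> (forall t, a <= t <= b -> c <= f t) -> lip f ->
  lip (fun t => (f t)^-1).
Proof.
move=> c0 cf [L L0 Lf]; exists (L / c ^+ 2); first by rewrite divr_ge0// exprn_ge0// ltW.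
move=> s t sab tab.
have fs := lt_le_trans c0 (cf s sab); have ft := lt_le_trans c0 (cf t tab).
have -> : (f s)^-1 - (f t)^-1 = (f t - f s) / (f s * f t).
  by field; rewrite !gt_eqF.
rewrite normrM distrC mulrAC ler_pM// ?Lf// normfV gtr0_norm ?mulr_gt0//.
by rewrite lef_pV2 ?posrE ?mulr_gt0 ?exprn_gt0// expr2 ler_pM// ?cf// ltW.
Qed.

Lemma lip_sqrt f c : 0 < c -> (forall t, a <= t <= b -> c <= f t) -> lip f ->
  lip (fun t => Num.sqrt (f t)).
Proof.
move=> c0 cf [L L0 Lf]; have sc0 : 0 < Num.sqrt c by rewrite sqrtr_gt0.
exists (L / Num.sqrt c); first by rewrite divr_ge0// ltW.
move=> s t sab tab; have fs := cf s sab; have ft := cf t tab.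
have fs0 := lt_le_trans c0 fs; have ft0 := lt_le_trans c0 ft.
have D0 : 0 < Num.sqrt (f s) + Num.sqrt (f t) by rewrite addr_gt0 ?sqrtr_gt0.
have -> : Num.sqrt (f s) - Num.sqrt (f t) =
    (f s - f t) / (Num.sqrt (f s) + Num.sqrt (f t)).
  rewrite -{2}(sqr_sqrtr (ltW fs0)) -{2}(sqr_sqrtr (ltW ft0)) subr_sqr mulfK//.
  exact: lt0r_neq0.
rewrite normrM mulrAC ler_pM// ?Lf// normfV gtr0_norm// lef_pV2 ?posrE//.
by rewrite (le_trans (ler_wsqrtr fs))// lerDl sqrtr_ge0.
Qed.

Lemma lipschitz_continuous (W : normedModType R) (f : R -> W) (L : R) :
  (forall s t, a <= s <= b -> a <= t <= b -> `|f s - f t| <= L * `|s - t|) ->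
  {within `[a, b]%classic, continuous f}.
Proof.
move=> Lf; apply/subspace_continuousP => x /= /[!in_itv]/= xab.
apply/cvgrPdist_lt => e e0.
have M0 : 0 < `|L| + 1 by rewrite ltr_wpDl.
apply/nbhs_ballP; exists (e / (`|L| + 1)); first by rewrite /= divr_gt0.
move=> y; rewrite -ball_normE/= ltr_pdivlMr// => xy /[!in_itv]/= yab.
apply: le_lt_trans (Lf _ _ xab yab) _; apply: le_lt_trans xy; rewrite mulrC ler_wpM2l//.
by rewrite (le_trans (ler_norm L))// lerDl.
Qed.

End Lipschitz.

(** * A family of resonant angles *)

Section Curve.
Context {R : realType}.
Variable P : R.
Hypothesis P100 : 100 <= P.

(** The angles and radii of a resonant triad, as functions of the defect [d] of
    the cosine of B below 1/2. The wave vectors are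
    [A = P^2 (1/2, sin_a)], [B = - rad_b (cos_b, sin_b)] and
    [C = rad_c (- cos_c, sin_c)]. With signs +, -, + their frequencies 1/2,
    [cos_b] and [- cos_c] add up to 0 for every [d], so that only the two
    coordinates of [A + B + C = 0] are left, which is a linear system for
    [rad_b] and [rad_c]. *)
Definition sin_a : R := Num.sqrt (3 / 4).
Definition cos_b (d : R) : R := 1 / 2 - d.
Definition sin_b (d : R) : R := Num.sqrt (1 - cos_b d ^+ 2).
Definition cos_c (d : R) : R := 1 - d.
Definition sin_c (d : R) : R := Num.sqrt (1 - cos_c d ^+ 2).

(** The sine of the angle between B and C up to sign: the determinant of that
    linear system. *)
Definition sin_bc (d : R) : R := cos_c d * sin_b d + cos_b d * sin_c d.

Definition rad_c (d : R) : R := P ^+ 2 * (sin_b d / 2 - cos_b d * sin_a) / sin_bc d.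
Definition rad_b (d : R) : R := (P ^+ 2 / 2 - rad_c d * cos_c d) / cos_b d.

(** By the law of sines [rad_c] is about [4/3 P^2 d]: for these [d] the wave
    vector C has length of order one. *)
Definition admissible (d : R) := 1 / P ^+ 2 <= d <= 4 / P ^+ 2.

Lemma sin_aE : sin_a ^+ 2 = 3 / 4.
Proof. by rewrite sqr_sqrtr//; lra. Qed.

Lemma sin_a_bounds : 43 / 50 <= sin_a <= 87 / 100.
Proof.
by apply/andP; split; rewrite -(ler_pXn2r (n := 2)) ?nnegrE ?sqrtr_ge0 ?sin_aE//; lra.
Qed.

Section Estimates.
Variable d : R.
Hypothesis dP : admissible d.

Let P0 : 0 < P. Proof. by apply: lt_le_trans P100; lra. Qed.
Let P2 : 400 <= P ^+ 2. Proof. move: P100; nra. Qed.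
Let P20 : 0 < P ^+ 2. Proof. move: P2; lra. Qed.

Lemma admissible_scaled : 1 <= P ^+ 2 * d <= 4.
Proof.
by move: dP; rewrite /admissible ler_pdivrMr// ler_pdivlMr// mulrC.
Qed.

Let d0 : 0 < d.
Proof. by move: admissible_scaled P2 => /andP[h _] h'; nra. Qed.

Let d4 : d <= 1 / 100.
Proof. by move: admissible_scaled P2 => /andP[_ h] h'; nra. Qed.

Lemma cos_b_bounds : 49 / 100 <= cos_b d <= 1 / 2.
Proof. by rewrite /cos_b; move: d0 d4; lra. Qed.

Lemma cos_c_bounds : 99 / 100 <= cos_c d <= 1.
Proof. by rewrite /cos_c; move: d0 d4; lra. Qed.

Lemma sin_bE : sin_b d ^+ 2 = 1 - cos_b d ^+ 2.
Proof. by rewrite sqr_sqrtr//; move: cos_b_bounds; nra. Qed.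

Lemma sin_cE : sin_c d ^+ 2 = 1 - cos_c d ^+ 2.
Proof. by rewrite sqr_sqrtr//; move: cos_c_bounds; nra. Qed.

Lemma sin_b_bounds : sin_a <= sin_b d <= 22 / 25.
Proof.
rewrite -[_ <= sin_b d](ler_pXn2r (n := 2)) ?nnegrE ?sqrtr_ge0//.
rewrite -[sin_b d <= _](ler_pXn2r (n := 2)) ?nnegrE ?sqrtr_ge0//.
rewrite sin_bE sin_aE /cos_b; have [h0 h4] := conj d0 d4.
by apply/andP; split; nra.
Qed.

(** C is nearly horizontal: its sine is about the square root of [2 d], which
    is the source of the blow-up. *)
Lemma sin_c_bounds : 1 / P <= sin_c d <= 3 / P.
Proof.
have [/andP[h1 h2] h0 h4] :=
  And3 admissible_scaled d0 d4.
have s0 : 0 <= sin_c d by exact: sqrtr_ge0.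
have q : (sin_c d * P) ^+ 2 = (1 - cos_c d ^+ 2) * P ^+ 2 by rewrite exprMn sin_cE.
have sP0 : 0 <= sin_c d * P by rewrite mulr_ge0// ltW.
rewrite ler_pdivrMr// ler_pdivlMr//; apply/andP; split.
  rewrite -(ler_pXn2r (n := 2)) ?nnegrE//.
  by rewrite q /cos_c; have N0 := P20; nra.
rewrite -(ler_pXn2r (n := 2)) ?nnegrE//.
by rewrite q /cos_c; have N0 := P20; nra.
Qed.

Let sin_c_small : 0 <= sin_c d <= 3 / 100.
Proof.
rewrite sqrtr_ge0/=; have /andP[_ /le_trans] := sin_c_bounds; apply.
by rewrite ler_pdivrMr//; move: P100; lra.
Qed.

Lemma sin_bc_bounds : 17 / 20 <= sin_bc d <= 9 / 10.
Proof.
have [/andP[a1 a2] /andP[b1 b2] /andP[c1 c2]] :=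
  And3 sin_a_bounds sin_b_bounds sin_c_small.
have [/andP[e1 e2] /andP[f1 f2]] := conj cos_b_bounds cos_c_bounds.
rewrite /sin_bc; apply/andP; split; nra.
Qed.

(** The numerator [sin_b / 2 - cos_b sin_a] is [(sin_b - sin_a) / 2 + d sin_a],
    and [sin_b - sin_a] is the quotient of [d - d^2] by [sin_b + sin_a]. Both
    terms are therefore of order [d]. *)
Lemma rad_c_bounds : 6 / 5 * (P ^+ 2 * d) <= rad_c d <= 3 / 2 * (P ^+ 2 * d).
Proof.
have [/andP[a1 a2] /andP[b1 b2] /andP[c1 c2]] :=
  And3 sin_a_bounds sin_b_bounds sin_bc_bounds.
have [/andP[h1 h2] h0 h4] :=
  And3 admissible_scaled d0 d4.
have D0 : 0 < sin_bc d by lra.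
rewrite /rad_c ler_pdivlMr// ler_pdivrMr//.
have dif : (sin_b d - sin_a) * (sin_b d + sin_a) = d - d ^+ 2.
  by rewrite -subr_sqr sin_bE sin_aE /cos_b; field.
have lo : 1 / 2 * d <= sin_b d - sin_a by nra.
have hi : sin_b d - sin_a <= 3 / 5 * d by nra.
have -> : sin_b d / 2 - cos_b d * sin_a = (sin_b d - sin_a) / 2 + d * sin_a.
  by rewrite /cos_b; field.
set q := _ / 2 + _.
have q1 : 11 / 10 * d <= q by rewrite /q; nra.
have q2 : q <= 6 / 5 * d by rewrite /q; nra.
have e1 : 6 / 5 * d * sin_bc d <= q by nra.
have e2 : q <= 3 / 2 * d * sin_bc d by nra.
have E x : x * (P ^+ 2 * d) * sin_bc d = P ^+ 2 * (x * d * sin_bc d) by ring.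
by rewrite !E !ler_pM2l// e1 e2.
Qed.

Lemma rad_c_range : 1 <= rad_c d <= 6.
Proof.
have [/andP[h1 h2] /andP[r1 r2]] := conj admissible_scaled rad_c_bounds.
by apply/andP; split; lra.
Qed.

Lemma rad_b_cos_b : rad_b d * cos_b d = P ^+ 2 / 2 - rad_c d * cos_c d.
Proof. by rewrite /rad_b divfK// gt_eqF//; move: cos_b_bounds; lra. Qed.

(** [rad_b] solves the first equation of the system by definition; the second
    one is what the definition of [rad_c] achieves. *)
Lemma rad_b_sin_b : rad_b d * sin_b d = P ^+ 2 * sin_a + rad_c d * sin_c d.
Proof.
have c0 : cos_b d != 0 by rewrite gt_eqF//; move: cos_b_bounds; lra.
have D0 : sin_bc d != 0 by rewrite gt_eqF//; move: sin_bc_bounds; lra.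
apply: (mulIf c0); rewrite mulrAC rad_b_cos_b.
have rD : rad_c d * sin_bc d = P ^+ 2 * (sin_b d / 2 - cos_b d * sin_a).
  by rewrite /rad_c divfK.
have -> : (P ^+ 2 / 2 - rad_c d * cos_c d) * sin_b d =
  P ^+ 2 * (sin_b d / 2 - cos_b d * sin_a) + P ^+ 2 * sin_a * cos_b d -
  rad_c d * cos_c d * sin_b d by field.
by rewrite -rD /sin_bc; ring.
Qed.

Lemma rad_b_bounds : 9 / 10 * P ^+ 2 <= rad_b d <= 2 * P ^+ 2.
Proof.
have [/andP[b1 b2] /andP[r1 r2] /andP[c1 c2]] :=
  And3 cos_b_bounds rad_c_range cos_c_bounds.
have := rad_b_cos_b; have := P2; move: (P ^+ 2) => N N0 e.
have e1 : N / 2 - 6 <= rad_b d * cos_b d by nra.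
have e2 : rad_b d * cos_b d <= N / 2 by nra.
have r0 : 0 < rad_b d by rewrite -(pmulr_lgt0 _ (_ : 0 < cos_b d)); lra.
by apply/andP; split; nra.
Qed.

(** The second factor of the interaction coefficient. Its terms of order [P^2]
    cancel; multiplied by [cos_b] it becomes
    [rad_c (cos_c + cos_b) - P^2 d], where [rad_c] is at least [6/5 P^2 d] and
    [cos_c + cos_b] is close to 3/2. *)
Lemma radius_defect : 1 <= P ^+ 2 - rad_b d + rad_c d.
Proof.
have [/andP[b1 b2] /andP[r1 r2] /andP[c1 c2]] :=
  And3 cos_b_bounds rad_c_bounds cos_c_bounds.
have [/andP[h1 h2] e] := conj admissible_scaled rad_b_cos_b.
have E : (P ^+ 2 - rad_b d + rad_c d) * cos_b d =
    rad_c d * (cos_c d + cos_b d) - P ^+ 2 * d.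
  by rewrite mulrDl mulrBl e /cos_b; field.
have : 1 / 2 <= (P ^+ 2 - rad_b d + rad_c d) * cos_b d by rewrite E; nra.
nra.
Qed.

(** The difference of the vertical components of the frequency gradients of C
    and B. The one of B is of order [1 / rad_b], hence of order [P^-2], while
    the one of C is of order [sin_c / rad_c], hence of order [P^-1]. *)
Lemma slope_gap : 1 / 10 / P <=
  sin_c d * cos_c d / rad_c d - sin_b d * cos_b d / rad_b d.
Proof.
have [/andP[b1 b2] /andP[r1 r2] /andP[c1 c2]] :=
  And3 cos_b_bounds rad_c_range cos_c_bounds.
have [/andP[s1 s2] /andP[t1 t2] /andP[u1 u2]] :=
  And3 sin_b_bounds sin_c_bounds rad_b_bounds.
have /andP[a1 a2] := sin_a_bounds.
have rB0 : 0 < rad_b d by move: P2; lra.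
have rC0 : 0 < rad_c d by lra.
have hC : 3 / 20 / P <= sin_c d * cos_c d / rad_c d.
  rewrite ler_pdivlMr//; apply: (@le_trans _ _ (1 / P * (99 / 100))).
    by rewrite -!mulrA ![_ * (P^-1 * _)]mulrCA ler_pM2l ?invr_gt0//; lra.
  by apply: ler_pM => //; rewrite ?divr_ge0// ?ltW//; lra.
have hB : sin_b d * cos_b d / rad_b d <= 1 / 20 / P.
  rewrite ler_pdivrMr//; apply: (@le_trans _ _ (1 / 2)); first by nra.
  rewrite mulrAC ler_pdivlMr//; move: u1 P100; nra.
have -> : 1 / 10 / P = 3 / 20 / P - (1 / 20) / P by field; rewrite gt_eqF.
lra.
Qed.

Lemma slope_sum : sin_c d / rad_c d + sin_b d / rad_b d <= 8 / 3 / P.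
Proof.
have [/andP[r1 r2] /andP[h1 h2]] := conj rad_c_bounds admissible_scaled.
have [/andP[s1 s2] /andP[t1 t2] /andP[u1 u2]] :=
  And3 sin_b_bounds sin_c_bounds rad_b_bounds.
have rB0 : 0 < rad_b d by move: P2; lra.
have rC0 : 0 < rad_c d by lra.
have hC : sin_c d / rad_c d <= 5 / 2 / P.
  rewrite ler_pdivrMr//; apply: le_trans t2 _.
  by rewrite mulrAC ler_pM2r ?invr_gt0//; lra.
have hB : sin_b d / rad_b d <= 1 / 10 / P.
  by rewrite ler_pdivrMr// mulrAC ler_pdivlMr//; move: u1 P100; nra.
have : 5 / 2 / P + (1 / 10) / P <= 8 / 3 / P.
  by rewrite -mulrDl ler_pM2r ?invr_gt0//; lra.
lra.
Qed.

End Estimates.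

Let lo := 1 / P ^+ 2.
Let hi := 4 / P ^+ 2.

Lemma lip_cos_b : lip lo hi cos_b.
Proof. by apply: lipB; [exact: lip_cst|exact: lip_id]. Qed.

Lemma lip_cos_c : lip lo hi cos_c.
Proof. by apply: lipB; [exact: lip_cst|exact: lip_id]. Qed.

Lemma lip_sin_b : lip lo hi sin_b.
Proof.
apply: (lip_sqrt (c := 1 / 2)); first by lra.
  by move=> t /cos_b_bounds /andP[? ?]; nra.
by apply: lipB; [exact: lip_cst|apply: lipM; exact: lip_cos_b].
Qed.

Lemma lip_sin_c : lip lo hi sin_c.
Proof.
have P0 : 0 < P by move: P100; lra.
apply: (lip_sqrt (c := (1 / P) ^+ 2)); first by rewrite exprn_gt0// divr_gt0.
  move=> t tP; rewrite -sin_cE//; have /andP[h _] := sin_c_bounds tP.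
  by rewrite ler_pXn2r ?nnegrE ?sqrtr_ge0// divr_ge0// ltW.
by apply: lipB; [exact: lip_cst|apply: lipM; exact: lip_cos_c].
Qed.

Lemma lip_rad_c : lip lo hi rad_c.
Proof.
have lD : lip lo hi sin_bc.
  by apply: lipD; apply: lipM;
    [exact: lip_cos_c|exact: lip_sin_b|exact: lip_cos_b|exact: lip_sin_c].
apply: lipM; last first.
  by apply: (lipV (c := 1 / 2)) lD => [|t /sin_bc_bounds/andP[? _]]; lra.
apply: lipM; first exact: lip_cst.
apply: lipB; apply: lipM; by [exact: lip_sin_b|exact: lip_cst|exact: lip_cos_b].
Qed.

End Curve.

(** * The resonant triads *)

Section Vectors.
Context {R : realType}.

Definition vec2 (x y : R) : 'rV[R]_2 := \row_i (if i == 0 then x else y).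

Lemma vec2_0 x y : vec2 x y 0 0 = x. Proof. by rewrite mxE. Qed.
Lemma vec2_1 x y : vec2 x y 0 1 = y. Proof. by rewrite mxE. Qed.

Lemma enorm_vec2 x y r : 0 <= r -> r ^+ 2 = x ^+ 2 + y ^+ 2 -> enorm (vec2 x y) = r.
Proof. by move=> r0 e; rewrite enorm2E vec2_0 vec2_1 -e sqrtr_sqr ger0_norm. Qed.

Lemma vec2_neq0 x y : 0 < enorm (vec2 x y) -> vec2 x y != 0.
Proof.
apply: contraTneq => ->; rewrite enorm2E !mxE expr0n/= addr0 sqrtr0 ltxx//.
Qed.

End Vectors.

Section Triad.
Context {R : realType}.
Variable P : R.
Hypothesis P100 : 100 <= P.

Let P2 : 400 <= P ^+ 2. Proof. move: P100; nra. Qed.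

Definition kA : 'rV[R]_2 := vec2 (P ^+ 2 / 2) (P ^+ 2 * sin_a).
Definition kB (d : R) : 'rV[R]_2 :=
  vec2 (- (rad_b P d * cos_b d)) (- (rad_b P d * sin_b d)).
Definition kC (d : R) : 'rV[R]_2 :=
  vec2 (- (rad_c P d * cos_c d)) (rad_c P d * sin_c d).

Lemma enorm_kA : enorm kA = P ^+ 2.
Proof.
apply: enorm_vec2; first by move: P2; lra.
by rewrite [(_ * sin_a) ^+ 2]exprMn sin_aE; field.
Qed.

Section OnCurve.
Variable d : R.
Hypothesis dP : admissible P d.

Lemma enorm_kB : enorm (kB d) = rad_b P d.
Proof.
have /andP[r0 _] := rad_b_bounds P100 dP.
apply: enorm_vec2; first by move: P2 r0; lra.
by rewrite !sqrrN !exprMn (sin_bE P100 dP); ring.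
Qed.

Lemma enorm_kC : enorm (kC d) = rad_c P d.
Proof.
have /andP[r0 _] := rad_c_range P100 dP.
apply: enorm_vec2; first by lra.
by rewrite !sqrrN !exprMn (sin_cE P100 dP); ring.
Qed.

Lemma rad_b_gt0 : 0 < rad_b P d.
Proof. by have /andP[r0 _] := rad_b_bounds P100 dP; move: P2 r0; lra. Qed.

Lemma rad_c_gt0 : 0 < rad_c P d.
Proof. by have /andP[r0 _] := rad_c_range P100 dP; lra. Qed.

Lemma kB_neq0 : kB d != 0.
Proof. by apply: vec2_neq0; rewrite enorm_kB rad_b_gt0. Qed.

Lemma kC_neq0 : kC d != 0.
Proof. by apply: vec2_neq0; rewrite enorm_kC rad_c_gt0. Qed.

Lemma kABC0 : kA + kB d + kC d = 0.
Proof.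
by apply: rV2P; rewrite !mxE/= ?(rad_b_cos_b P100 dP) ?(rad_b_sin_b P100 dP); ring.
Qed.

Lemma omega_kC s : omega (s, kC d) = - (sgn s * cos_c d).
Proof.
rewrite /omega/= enorm_kC vec2_0 mulNr mulrAC divff ?mul1r ?mulrN//.
by rewrite gt_eqF// rad_c_gt0.
Qed.

Lemma omega_kB s : omega (s, kB d) = - (sgn s * cos_b d).
Proof.
rewrite /omega/= enorm_kB vec2_0 mulNr mulrAC divff ?mul1r ?mulrN//.
by rewrite gt_eqF// rad_b_gt0.
Qed.

End OnCurve.

Lemma kA_neq0 : kA != 0.
Proof. by apply: vec2_neq0; rewrite enorm_kA; move: P2; lra. Qed.

Lemma omega_kA : omega (true, kA) = 1 / 2.
Proof.
have P0 : P != 0 by rewrite gt_eqF//; move: P100; lra.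
by rewrite /omega /sgn/= enorm_kA vec2_0; field.
Qed.

Definition triad (d : R) : 'rV[R]_(2 + 2) := row_mx (kB d) (kC d).

(** The triads with the roles of the two integration variables exchanged: they
    lie in the resonant sets for the exchanged signs. *)
Definition triad_swap (d : R) : 'rV[R]_(2 + 2) := row_mx (kC d) (kB d).

Lemma resonant_triad d : admissible P d ->
  resonant_set (true, kA) false true (triad d).
Proof.
move=> dP; split; rewrite ?row_mxKl ?row_mxKr ?kB_neq0 ?kC_neq0//.
rewrite /resonance_map row_mxKl row_mxKr kABC0// omega_kA omega_kB// omega_kC//.
rewrite (_ : _ + _ + _ = 0) ?raddf0 ?row_mx0//.
by rewrite /sgn /cos_b /cos_c; field.
Qed.

Definition triad_segment : set R := `[1 / P ^+ 2, 4 / P ^+ 2]%classic.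

Lemma triad_segmentP d : triad_segment d <-> admissible P d.
Proof. by rewrite /triad_segment/= in_itv. Qed.

Definition lip_vector n (k : R -> 'rV[R]_n) := exists2 L, 0 <= L &
  forall s t, admissible P s -> admissible P t -> enorm (k s - k t) <= L * `|s - t|.

Lemma lip_vectorP n (k : R -> 'rV[R]_n) :
  (forall i, lip (1 / P ^+ 2) (4 / P ^+ 2) (fun d => k d 0 i)) -> lip_vector k.
Proof.
move=> kl; pose L i := s2val (cid2 (kl i)).
have L0 i : 0 <= L i by rewrite /L; case: cid2.
exists (\sum_i L i); first by apply: sumr_ge0.
move=> s t sP tP; apply: le_trans (enorm_le_sum _) _; rewrite mulr_suml.
apply: ler_sum => i _; rewrite !mxE /L; case: cid2 => /= M _; exact.
Qed.

Lemma lip_kC i : lip (1 / P ^+ 2) (4 / P ^+ 2) (fun d => kC d 0 i).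
Proof.
case: (ord2P i) => ->.
  under eq_fun do rewrite vec2_0.
  by apply/lipN/lipM; [exact: lip_rad_c|exact: lip_cos_c].
under eq_fun do rewrite vec2_1.
by apply: lipM; [exact: lip_rad_c|exact: lip_sin_c].
Qed.

(** The coordinates of B are affine in those of C by momentum conservation. *)
Lemma lip_kB i : lip (1 / P ^+ 2) (4 / P ^+ 2) (fun d => kB d 0 i).
Proof.
suff [L L0 h] : lip (1 / P ^+ 2) (4 / P ^+ 2) (fun d => - kA 0 i - kC d 0 i).
  have kE d : admissible P d -> kB d 0 i = - kA 0 i - kC d 0 i.
    have E (u v : 'rV[R]_2) : (- u - v) 0 i = - u 0 i - v 0 i by rewrite !mxE.
    move=> dP; suff -> : kB d = - kA - kC d by rewrite E.
    apply: (addrI kA); apply: (addIr (kC d)).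
    by rewrite kABC0// addrA subrr sub0r addNr.
  exists L => // s t sP tP.
  by rewrite !kE//; exact: h.
by apply: lipB; [exact: lip_cst|exact: lip_kC].
Qed.

Lemma lip_vector_kC : lip_vector kC.
Proof. by apply: lip_vectorP => i; exact: lip_kC. Qed.

Lemma lip_vector_kB : lip_vector kB.
Proof. by apply: lip_vectorP => i; exact: lip_kB. Qed.

Lemma lip_vector_row_mx (k k' : R -> 'rV[R]_2) :
  (forall i, lip (1 / P ^+ 2) (4 / P ^+ 2) (fun d => k d 0 i)) ->
  (forall i, lip (1 / P ^+ 2) (4 / P ^+ 2) (fun d => k' d 0 i)) ->
  lip_vector (fun d => row_mx (k d) (k' d)).
Proof.
move=> kl kl'; apply: lip_vectorP => i; case: (split_ordP i) => j ->.
  by under eq_fun do rewrite row_mxEl; exact: kl.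
by under eq_fun do rewrite row_mxEr; exact: kl'.
Qed.

Lemma closed_lip_image n (k : R -> 'rV[R]_n) : lip_vector k ->
  closed (k @` triad_segment).
Proof.
move=> [L L0 kL]; apply: compact_closed; first exact: norm_hausdorff.
apply: continuous_compact; last exact: segment_compact.
apply: (lipschitz_continuous (L := L)) => s t sP tP.
by apply: le_trans (norm_le_enorm _) _; exact: kL.
Qed.

Lemma hausdorff1_lip_image n (k : R -> 'rV[R]_n) : lip_vector k ->
  (hausdorff1 (k @` triad_segment) < +oo)%E.
Proof.
move=> [L L0 kL]; apply: le_lt_trans (hausdorff1_lipschitz_image _ L0 kL) (ltry _).
by rewrite ler_pM2r ?invr_gt0//; move: P2; lra.
Qed.

(** The first coordinate of C is [- rad_c cos_c]. Between the two ends of the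
    segment it goes from at least -3/2 to at most -4, so by continuity it takes
    all values of [[-4, -2]]. *)
Lemma hausdorff1_triad : (1%:E <= hausdorff1 (triad @` triad_segment))%E.
Proof.
have P20 : 0 < P ^+ 2 by move: P2; lra.
have ab : 1 / P ^+ 2 <= 4 / P ^+ 2 :> R by rewrite ler_pM2r ?invr_gt0//; lra.
have ad1 : admissible P (1 / P ^+ 2) by rewrite /admissible lexx ab.
have ad4 : admissible P (4 / P ^+ 2) by rewrite /admissible lexx ab.
have e1 : P ^+ 2 * (1 / P ^+ 2) = 1 by rewrite mulrC divfK ?gt_eqF.
have e4 : P ^+ 2 * (4 / P ^+ 2) = 4 by rewrite mulrC divfK ?gt_eqF.
have /andP[_] := rad_c_bounds P100 ad1; rewrite e1 => r1.
have /andP[+ _] := rad_c_bounds P100 ad4; rewrite e4 => r4.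
have /andP[c1 c1'] := cos_c_bounds P100 ad1; have /andP[c4 c4'] := cos_c_bounds P100 ad4.
have /andP[r1' _] := rad_c_range P100 ad1.
apply: le_trans (hausdorff1_projection (i := rshift 2 0) (a := -4) (b := -2) _ _).
- by rewrite lee_fin; lra.
- by lra.
move=> u /andP[u4 u2].
have [||d dP du] := @IVT R (fun d => kC d 0 0) _ _ u ab.
- have [L L0 h] := lip_kC 0.
  exact: (lipschitz_continuous h).
- rewrite !vec2_0 ge_min le_max; apply/andP; split.
    by apply/orP; right; nra.
  by apply/orP; left; nra.
exists (triad d); first by exists d.
by rewrite row_mxEr.
Qed.

End Triad.

(** * The density *)

Section Density.
Context {R : realType}.
Variables (P m : R).
Hypothesis P100 : 100 <= P.
Hypothesis m0 : 0 < m.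

Let P2 : 400 <= P ^+ 2. Proof. move: P100; nra. Qed.

(** Only the C's of the family for the sign + and its B's for the sign - are
    charged; the factor [P^(-2 m)] compensates the weight at the B's, whose
    length is of order [P^2]. *)
Definition density : mode R -> R := fun a =>
  if a.1 then \1_(kC P @` triad_segment P) a.2
  else (P ^+ 2) `^ (- m) * \1_(kB P @` triad_segment P) a.2.

Lemma density_ge0 a : 0 <= density a.
Proof. by rewrite /density; case: a.1; rewrite ?mulr_ge0 ?powR_ge0 ?indicE. Qed.

Lemma density_le1 a : density a <= 1.
Proof.
have nu1 : (P ^+ 2) `^ (- m) <= 1.
  have N1 : 1 <= P ^+ 2 by move: P2; lra.
  rewrite powRN invf_le1 ?powR_gt0 ?(lt_le_trans ltr01 N1)//.
  by rewrite -(powRr0 (P ^+ 2)) ler_powR ?(ltW m0).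
rewrite /density; case: a.1 => /=; first by rewrite ?indicE lern1 leq_b1.
by apply: mulr_ile1; rewrite ?powR_ge0// indicE ?lern1 ?leq_b1.
Qed.

Lemma density_false_neq0 k : density (false, k) != 0 ->
  exists2 d, admissible P d & k = kB P d.
Proof.
rewrite /density/= indicE; have [|_] := boolP (k \in _); last by rewrite mulr0 eqxx.
by rewrite inE => -[d /triad_segmentP dP <-] _; exists d.
Qed.

Lemma density_true_neq0 k : density (true, k) != 0 ->
  exists2 d, admissible P d & k = kC P d.
Proof.
rewrite /density/= indicE; have [|_] := boolP (k \in _); last by rewrite eqxx.
by rewrite inE => -[d /triad_segmentP dP <-] _; exists d.
Qed.

Lemma density_kB d : admissible P d -> density (false, kB P d) = (P ^+ 2) `^ (- m).
Proof. by move=> dP; rewrite /density/= indicE mem_set ?mulr1. Qed.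

Lemma density_kC d : admissible P d -> density (true, kC P d) = 1.
Proof.
by move=> dP; rewrite /density/= indicE mem_set//; exists d => //; exact/triad_segmentP.
Qed.

Lemma density_kA : density (true, kA P) = 0.
Proof.
apply/eqP; apply: contraT => /density_true_neq0[d dP /(congr1 (@enorm R 2))].
rewrite enorm_kA// enorm_kC// => e.
by have := rad_c_range P100 dP; rewrite -e; move: P2; lra.
Qed.

Lemma japanese_gt0 (k : 'rV[R]_2) : 0 < japanese k.
Proof. by rewrite sqrtr_gt0 ltr_pwDl// sqr_ge0. Qed.

Lemma japanese_le (k : 'rV[R]_2) r : 0 <= r -> 1 + enorm k ^+ 2 <= r ^+ 2 ->
  japanese k <= r.
Proof. by move=> r0 h; rewrite -(ger0_norm r0) -sqrtr_sqr ler_wsqrtr. Qed.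

Lemma enorm_le_japanese (k : 'rV[R]_2) : enorm k <= japanese k.
Proof.
by rewrite -[enorm k]ger0_norm ?enorm_ge0// -sqrtr_sqr ler_wsqrtr// lerDr.
Qed.

Lemma wnorm_density : (wnorm m density <= (7 `^ m)%:E)%E.
Proof.
apply: ge_ereal_sup => _ [[s k] _ <-]; rewrite lee_fin.
have [->|] := eqVneq (density (s, k)) 0; first by rewrite normr0 mulr0 powR_ge0.
have j0 := ltW (japanese_gt0 k).
(* The C's have length at most 6, and the B's at most [2 P^2], so that their
   weights are at most [7^m] and [(3 P^2)^m]. *)
case: s => nz.
  have [d dP kE] := density_true_neq0 nz; have /andP[r1 r6] := rad_c_range P100 dP.
  rewrite kE density_kC// normr1 mulr1 ge0_ler_powR ?nnegrE ?(ltW m0)//=.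
    by apply: sqrtr_ge0.
  by apply: japanese_le => //; rewrite enorm_kC//; nra.
have [d dP kE] := density_false_neq0 nz; have /andP[r1 r6] := rad_b_bounds P100 dP.
rewrite kE density_kB// ger0_norm ?powR_ge0// powRN.
have N0 : 0 < P ^+ 2 by move: P2; lra.
rewrite ler_pdivrMr ?powR_gt0// -powRM ?(ltW N0)//.
rewrite ge0_ler_powR ?nnegrE ?(ltW m0) ?sqrtr_ge0//; first by rewrite mulr_ge0// ltW.
apply: japanese_le; first by rewrite mulr_ge0// ltW.
by rewrite enorm_kB//; move: P2 r1 r6; nra.
Qed.

Lemma density_Linfty : Linfty m density.
Proof.
split=> [s|a|]; last by apply: le_lt_trans wnorm_density (ltry _).
- have mI (k : R -> 'rV[R]_2) : lip_vector P k ->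
      measurable_fun [set: g_sigma_algebraType (@open 'rV[R]_2)]
        (\1_(k @` triad_segment P) : _ -> R).
    move=> kl; apply: measurable_realfun.measurable_indic.
    rewrite -[X in _.-measurable X]setCK; apply: measurableC.
    by apply: sub_sigma_algebra; apply: closed_openC; exact: closed_lip_image kl.
  rewrite /density; case: s => /=.
    by apply: mI; exact: lip_vector_kC.
  apply: measurable_realfun.measurable_funM; first exact: measurable_cst.
  by apply: mI; exact: lip_vector_kB.
- exact: density_ge0.
Qed.

End Density.

(** * Pointwise bounds on the collision integrand *)

Section CollisionBound.
Context {R : realType}.
Variables (P m eps : R) (chi : R -> R).
Hypothesis P100 : 100 <= P.
Hypothesis m0 : 0 < m.
Hypothesis eps8 : 0 < eps < 1 / 8.
Hypothesis chiP : zero_frequency_cutoff eps chi.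

Let P2 : 400 <= P ^+ 2. Proof. move: P100; nra. Qed.
Let P0 : 0 < P. Proof. move: P100; lra. Qed.

Let nu := (P ^+ 2) `^ (- m).
Let n := density P m.
Let alpha : mode R := (true, kA P).

Let chi01 t : 0 <= chi t <= 1. Proof. by case: chiP. Qed.

Let chi_eq1 (k : 'rV[R]_2) : k != 0 -> 1 / 4 <= `|k 0 0 / enorm k| ->
  chi (angle k) = 1.
Proof.
move=> k0 h; case: chiP => _ _ _ _ /(_ (angle k)) [_]; apply.
by rewrite (angleE k0).1; move: eps8 h; lra.
Qed.

Let nu0 : 0 < nu. Proof. by rewrite powR_gt0//; move: P2; lra. Qed.

(** The density vanishes at A, which leaves only the term of the cubic
    expression that is a square of the frequency of A times the densities at B
    and C. The integrand is therefore nonnegative and nothing can cancel. *)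
Lemma collision_integrandE b c : collision_integrand chi n alpha b c =
  Gamma alpha b c ^+ 2 * (1 / 4) *
  (chi (angle (kA P)) * chi (angle b.2) * chi (angle c.2)) * (n b * n c).
Proof.
have nA : n alpha = 0 by exact: density_kA.
have wA : omega alpha = 1 / 2 by exact: omega_kA.
by rewrite /collision_integrand nA wA; field.
Qed.

Lemma cutoff_prod01 (k b c : 'rV[R]_2) :
  0 <= chi (angle k) * chi (angle b) * chi (angle c) <= 1.
Proof.
have [/andP[k0 k1] /andP[b0 b1] /andP[c0 c1]] :=
  And3 (chi01 (angle k)) (chi01 (angle b)) (chi01 (angle c)).
by rewrite !mulr_ge0//= !mulr_ile1// mulr_ge0.
Qed.

Lemma collision_integrand_ge0 b c : 0 <= collision_integrand chi n alpha b c.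
Proof.
rewrite collision_integrandE; have /andP[c0 _] := cutoff_prod01 (kA P) b.2 c.2.
apply: mulr_ge0; last by rewrite mulr_ge0 ?density_ge0.
by apply: mulr_ge0 => //; rewrite mulr_ge0 ?sqr_ge0.
Qed.

Lemma Gamma_le (a b c : mode R) : a.2 != 0 -> b.2 != 0 -> c.2 != 0 ->
  `|Gamma a b c| <= pi ^+ 2 * 3 * (enorm a.2 + enorm b.2 + enorm c.2).
Proof.
move=> a0 b0 c0; have sin1 (k : 'rV[R]_2) s : `|sgn s * sin (angle k)| <= 1.
  by rewrite normr_sgnM ler_norml sin_geN1 sin_le1.
have en (k : 'rV[R]_2) s : `|sgn s * enorm k| <= enorm k.
  by rewrite normr_sgnM ger0_norm ?enorm_ge0.
have tri (x y z : R) : `|x + y + z| <= `|x| + `|y| + `|z|.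
  by apply: le_trans (ler_normD _ _) _; rewrite lerD2r ler_normD.
rewrite /Gamma 2!normrM (ger0_norm (sqr_ge0 pi)).
apply: ler_pM => //; first by rewrite mulr_ge0// sqr_ge0.
  rewrite ler_wpM2l ?sqr_ge0//; apply: le_trans (tri _ _ _) _.
  have := sin1 a.2 a.1; have := sin1 b.2 b.1; have := sin1 c.2 c.1; lra.
by apply: le_trans (tri _ _ _) _; rewrite !lerD.
Qed.

Section Support.
Variables (sb sc : bool) (x : 'rV[R]_(2 + 2)).
Hypothesis xR : resonant_set alpha sb sc x.

Let momentum : kA P + lsubmx x + rsubmx x = 0.
Proof. by case: xR => _ _ /(congr1 rsubmx); rewrite row_mxKr raddf0. Qed.

(** Two C's are too short to balance A, and two B's give about [- 2 A]. So one
    of the two wave vectors is a C of the family, and momentum conservation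
    determines the other one. *)
Lemma support_triad : n (sb, lsubmx x) * n (sc, rsubmx x) != 0 ->
  exists2 d, admissible P d & x = triad P d \/ x = triad_swap P d.
Proof.
have x0 := congr1 (fun v : 'rV[R]_2 => v 0 0) momentum.
have mom k k' : kA P + k + k' = 0 -> k' = - (kA P + k).
  by move/eqP; rewrite addrC addr_eq0 => /eqP.
rewrite mulf_eq0 negb_or => /andP[].
have xE : x = row_mx (lsubmx x) (rsubmx x) by rewrite hsubmxK.
have small d : admissible P d -> 0 <= rad_c P d * cos_c d <= 6.
  move=> dP; have := rad_c_range P100 dP; have := cos_c_bounds P100 dP; nra.
rewrite /n; case: sb; case: sc.
- move=> /density_true_neq0[d dP kE] /density_true_neq0[d' dP' kE']; exfalso; move: x0.
  rewrite kE kE' !mxE/=; have := small _ dP; have := small _ dP'; move: P2; lra.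
- move=> /density_true_neq0[d dP kE] _; exists d => //; right.
  rewrite xE kE; congr row_mx.
  rewrite (mom _ _ momentum) kE; apply/esym/mom.
  by rewrite addrAC (kABC0 P100 dP).
- move=> _ /density_true_neq0[d dP kE]; exists d => //; left.
  rewrite xE kE; congr row_mx.
  move: momentum; rewrite addrAC => /mom ->; rewrite kE; apply/esym/mom.
  by rewrite addrAC (kABC0 P100 dP).
- move=> /density_false_neq0[d dP kE] /density_false_neq0[d' dP' kE']; exfalso; move: x0.
  rewrite kE kE' !mxE/= (rad_b_cos_b P100 dP) (rad_b_cos_b P100 dP').
  have := small _ dP; have := small _ dP'; move: P2; lra.
Qed.

End Support.

Section OnCurve.
Variable d : R.
Hypothesis dP : admissible P d.

Lemma slope_kB : `|grad_dircos (kB P d) 0 1| = sin_b d * cos_b d / rad_b P d.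
Proof.
have r0 := rad_b_gt0 P100 dP.
have [/andP[b1 _] /andP[s1 _] /andP[a1 _]] :=
  And3 (cos_b_bounds P100 dP) (sin_b_bounds P100 dP) (@sin_a_bounds R).
rewrite !mxE/= enorm_kB// (_ : _ * _ = - (sin_b d * cos_b d / rad_b P d)).
  have s0 : 0 <= sin_b d by lra.
  have c0 : 0 <= cos_b d by lra.
  rewrite normrN ger0_norm//.
  by apply: divr_ge0; [exact: mulr_ge0|exact: ltW].
by field; exact: lt0r_neq0.
Qed.

Lemma slope_kC : `|grad_dircos (kC P d) 0 1| = sin_c d * cos_c d / rad_c P d.
Proof.
have r0 := rad_c_gt0 P100 dP.
have /andP[b1 _] := cos_c_bounds P100 dP.
rewrite !mxE/= enorm_kC// (_ : _ * _ = sin_c d * cos_c d / rad_c P d).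
  have c0 : 0 <= cos_c d by lra.
  rewrite ger0_norm//.
  by apply: divr_ge0; [by rewrite mulr_ge0// sqrtr_ge0|exact: ltW].
by field; exact: lt0r_neq0.
Qed.

Lemma coarea_triad_ge sb sc : 1 / 10 / P <= coarea_factor alpha sb sc (triad P d).
Proof.
have := coarea_factor_ge alpha sb sc; move=> /(_ (triad P d)).
rewrite !row_mxKl !row_mxKr => /(_ (kB_neq0 P100 dP) (kC_neq0 P100 dP)).
apply: le_trans; rewrite slope_kB slope_kC distrC.
by apply: le_trans (ler_norm _); exact: slope_gap.
Qed.

Lemma coarea_triad_swap_ge sb sc :
  1 / 10 / P <= coarea_factor alpha sb sc (triad_swap P d).
Proof.
have := coarea_factor_ge alpha sb sc; move=> /(_ (triad_swap P d)).
rewrite !row_mxKl !row_mxKr => /(_ (kC_neq0 P100 dP) (kB_neq0 P100 dP)).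
apply: le_trans; rewrite slope_kB slope_kC.
by apply: le_trans (ler_norm _); exact: slope_gap.
Qed.

Lemma coarea_triad_le sb sc : coarea_factor alpha sb sc (triad P d) <= 8 / P.
Proof.
have := coarea_factor_le alpha sb sc; move=> /(_ (triad P d)).
rewrite !row_mxKl !row_mxKr => /(_ (kB_neq0 P100 dP) (kC_neq0 P100 dP)).
move=> /le_trans; apply.
have rb := rad_b_gt0 P100 dP; have rc := rad_c_gt0 P100 dP.
have [/andP[s1 _] /andP[a1 _]] := conj (sin_b_bounds P100 dP) (@sin_a_bounds R).
have sc0 : 0 <= sin_c d by exact: sqrtr_ge0.
have sb0 : 0 <= sin_b d by lra.
rewrite !vec2_1 normrN enorm_kB// enorm_kC//.
rewrite (ger0_norm (mulr_ge0 (ltW rb) sb0)) (ger0_norm (mulr_ge0 (ltW rc) sc0)).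
have -> : rad_b P d * sin_b d / rad_b P d ^+ 2 + rad_c P d * sin_c d / rad_c P d ^+ 2 =
   sin_c d / rad_c P d + sin_b d / rad_b P d by field; rewrite !gt_eqF.
by have := slope_sum P100 dP; lra.
Qed.

(** All three sines contribute with the same sign, and the sum of the signed
    lengths is bounded below by [radius_defect]. *)
Lemma Gamma_triad_ge1 : 1 <= Gamma alpha (false, kB P d) (true, kC P d).
Proof.
have rb := rad_b_gt0 P100 dP; have rc := rad_c_gt0 P100 dP.
have NA : P ^+ 2 != 0 by rewrite gt_eqF//; move: P2; lra.
have [/andP[s1 _] /andP[a1 _]] := conj (sin_b_bounds P100 dP) (@sin_a_bounds R).
have sc0 : 0 <= sin_c d by exact: sqrtr_ge0.
rewrite /Gamma/= (angleE (kA_neq0 P100)).2 (angleE (kB_neq0 P100 dP)).2.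
rewrite (angleE (kC_neq0 P100 dP)).2.
rewrite enorm_kA// enorm_kB// enorm_kC// !vec2_1 /sgn.
have -> : 1 * (P ^+ 2 * sin_a / P ^+ 2) + -1 * (- (rad_b P d * sin_b d) / rad_b P d) +
   1 * (rad_c P d * sin_c d / rad_c P d) = sin_a + sin_b d + sin_c d.
  by field; rewrite !gt_eqF.
have D := radius_defect P100 dP.
have -> : 1 * P ^+ 2 + -1 * rad_b P d + 1 * rad_c P d =
    P ^+ 2 - rad_b P d + rad_c P d by ring.
have p2 : 4 <= pi ^+ 2 :> R by have := @pi_ge2 R; nra.
have e : 1 <= pi ^+ 2 * (sin_a + sin_b d + sin_c d) by nra.
nra.
Qed.

Lemma collision_integrand_triad_ge :
  nu / 4 <= collision_integrand chi n alpha (false, kB P d) (true, kC P d).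
Proof.
have rb := rad_b_gt0 P100 dP; have rc := rad_c_gt0 P100 dP.
have NA : P ^+ 2 != 0 by rewrite gt_eqF//; move: P2; lra.
have [/andP[b1 b2] /andP[c1 c2]] := conj (cos_b_bounds P100 dP) (cos_c_bounds P100 dP).
have chiA : chi (angle (kA P)) = 1.
  apply: chi_eq1; first exact: kA_neq0.
  by rewrite enorm_kA// vec2_0 mulrAC divff// mul1r ger0_norm; lra.
have chiB : chi (angle (kB P d)) = 1.
  apply: chi_eq1; first exact: kB_neq0.
  by rewrite enorm_kB// vec2_0 mulNr normrN mulrAC divff ?gt_eqF// mul1r ger0_norm; lra.
have chiC : chi (angle (kC P d)) = 1.
  apply: chi_eq1; first exact: kC_neq0.
  by rewrite enorm_kC// vec2_0 mulNr normrN mulrAC divff ?gt_eqF// mul1r ger0_norm; lra.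
rewrite collision_integrandE /n (density_kB _ dP) (density_kC _ dP) mulr1 -/nu /=.
rewrite chiA chiB chiC !mulr1.
have : 1 <= Gamma alpha (false, kB P d) (true, kC P d) ^+ 2.
  by rewrite expr_ge1//; [exact: Gamma_triad_ge1|apply: le_trans Gamma_triad_ge1].
by move: (_ ^+ 2) nu0 => g h g1; nra.
Qed.

End OnCurve.

End CollisionBound.

(** * Blow-up of the collision operator *)

(** One term bounds the sum from below only if all terms are finite, because
    [fine] sends an infinite sum to 0. *)
Lemma fine_sum_bool_ge (R : realType) (I : bool -> bool -> \bar R) (v : R) :
  (forall sb sc, 0 <= I sb sc)%E -> (forall sb sc, I sb sc < +oo)%E ->
  (v%:E <= I false true)%E ->
  v <= fine (\sum_(sb : bool) \sum_(sc : bool) I sb sc)%E.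
Proof.
move=> I0 Ioo vI; rewrite !big_bool /=.
have S0 : (0 <= I true true + I true false + (I false true + I false false))%E.
  by rewrite !adde_ge0.
rewrite -lee_fin fineK; first by apply: le_trans vI _; rewrite addeCA leeDl// !adde_ge0.
by rewrite ge0_fin_numE// !lte_add_pinfty.
Qed.

Section CollisionValue.
Context {R : realType}.
Variables (P m eps : R) (chi : R -> R).
Hypothesis P100 : 100 <= P.
Hypothesis m0 : 0 < m.
Hypothesis eps8 : 0 < eps < 1 / 8.
Hypothesis chiP : zero_frequency_cutoff eps chi.

Let P2 : 400 <= P ^+ 2. Proof. move: P100; nra. Qed.
Let P0 : 0 < P. Proof. move: P100; lra. Qed.
Let nu := (P ^+ 2) `^ (- m).
Let nu0 : 0 < nu. Proof. by rewrite powR_gt0//; move: P2; lra. Qed.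

Let n := density P m.
Let alpha : mode R := (true, kA P).
Let mu := @hausdorff1_measure R (2 + 2).
Let E := triad P @` triad_segment P.
Let E' := triad_swap P @` triad_segment P.

Let lipE : lip_vector P (triad P).
Proof. by apply: lip_vector_row_mx => i; [exact: lip_kB|exact: lip_kC]. Qed.

Let lipE' : lip_vector P (triad_swap P).
Proof. by apply: lip_vector_row_mx => i; [exact: lip_kC|exact: lip_kB]. Qed.

Let mE : measurable (E : set (caratheodory_type (@hausdorff1 R (2 + 2)))).
Proof. exact: closed_caratheodory (closed_lip_image lipE). Qed.

Let mE' : measurable (E' : set (caratheodory_type (@hausdorff1 R (2 + 2)))).
Proof. exact: closed_caratheodory (closed_lip_image lipE'). Qed.

Let mEE' : measurable (E `|` E' : set (caratheodory_type (@hausdorff1 R (2 + 2)))).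
Proof. exact: measurableU. Qed.

Let muE_fin : (mu (E `|` E') < +oo)%E.
Proof.
apply: le_lt_trans (measureU2 _ mE mE') _.
by rewrite lte_add_pinfty//; exact: hausdorff1_lip_image.
Qed.

Let D sb sc : set 'rV[R]_(2 + 2) :=
  resonant_set alpha sb sc `&` [set x | coarea_factor alpha sb sc x != 0].
Let f sb sc (x : 'rV[R]_(2 + 2)) : R :=
  collision_integrand chi n alpha (sb, lsubmx x) (sc, rsubmx x)
  / coarea_factor alpha sb sc x.

Let f_ge0 sb sc x : D sb sc x -> 0 <= f sb sc x.
Proof.
move=> _; apply: divr_ge0; last exact: sqrtr_ge0.
exact: collision_integrand_ge0 chiP _ _.
Qed.

Let f_out sb sc x : D sb sc x -> ~ (E `|` E') x -> f sb sc x = 0.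
Proof.
move=> [xR _] xE; rewrite /f collision_integrandE//.
have [->|nz] := eqVneq (n (sb, lsubmx x) * n (sc, rsubmx x)) 0.
  by rewrite mulr0 mul0r.
exfalso; apply: xE; have [d dP []->] := support_triad P100 xR nz.
  by left; exists d => //; exact/triad_segmentP.
by right; exists d => //; exact/triad_segmentP.
Qed.

(** The square of the bound [Gamma_le] for wave vectors of total length
    [4 P^2], times the square of the frequency of A, divided by the lower bound
    [1 / (10 P)] of the coarea factor. *)
Let K : R := (pi ^+ 2 * 3 * (4 * P ^+ 2)) ^+ 2 * (1 / 4) * (10 * P).

Let f_le sb sc x : D sb sc x -> (E `|` E') x -> f sb sc x <= K.
Proof.
move=> [[b0 c0 _] _] xE.
have [J G] : 1 / 10 / P <= coarea_factor alpha sb sc x /\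
    enorm (kA P) + enorm (lsubmx x) + enorm (rsubmx x) <= 4 * P ^+ 2.
  case: xE => -[d /triad_segmentP dP <-].
    split; first exact: coarea_triad_ge.
    rewrite row_mxKl row_mxKr enorm_kA// enorm_kB// enorm_kC//.
    by have := rad_b_bounds P100 dP; have := rad_c_range P100 dP; move: P2; lra.
  split; first exact: coarea_triad_swap_ge.
  rewrite row_mxKl row_mxKr enorm_kA// enorm_kB// enorm_kC//.
  by have := rad_b_bounds P100 dP; have := rad_c_range P100 dP; move: P2; lra.
have J0 : 0 < (1 / 10) / P by rewrite !divr_gt0.
have G2 : Gamma alpha (sb, lsubmx x) (sc, rsubmx x) ^+ 2 <=
    (pi ^+ 2 * 3 * (4 * P ^+ 2)) ^+ 2.
  rewrite -real_normK ?num_real// ler_pXn2r ?nnegrE ?mulr_ge0 ?pi_ge0 ?(ltW P0)//.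
  apply: le_trans (Gamma_le _ _ _) _ => //=; first exact: kA_neq0.
  by rewrite ler_wpM2l// !mulr_ge0 ?pi_ge0.
rewrite /f /K collision_integrandE//.
have w0 : 0 <= n (sb, lsubmx x) * n (sc, rsubmx x) by rewrite mulr_ge0 ?density_ge0.
have w1 : n (sb, lsubmx x) * n (sc, rsubmx x) <= 1.
  by rewrite mulr_ile1 ?density_ge0 ?density_le1.
move: w0 w1 G2; set w := n _ * n _; set g := Gamma _ _ _ ^+ 2 => w0 w1 G2.
have g0 : 0 <= g * (1 / 4) by rewrite mulr_ge0// sqr_ge0.
have /andP[x0 x1] := cutoff_prod01 chiP (kA P) (lsubmx x) (rsubmx x).
apply: ler_pM.
- by apply: mulr_ge0 => //; exact: mulr_ge0.
- by rewrite invr_ge0 sqrtr_ge0.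
- rewrite -[X in X <= _]mulrA; apply: (@le_trans _ _ (g * (1 / 4))).
    by apply: ler_piMr => //; exact: mulr_ile1.
  by rewrite ler_wpM2r.
rewrite (_ : 10 * P = ((1 / 10) / P)^-1); last by field; rewrite gt_eqF.
by rewrite lef_pV2 ?posrE// (lt_le_trans J0).
Qed.

Let I sb sc := (\int[mu]_(x in D sb sc) (f sb sc x)%:E)%E.

Let I_ge0 sb sc : (0 <= I sb sc)%E.
Proof. by apply: integral_ge0 => x Dx; rewrite lee_fin f_ge0. Qed.

Let K0 : 0 <= K.
Proof. by rewrite !mulr_ge0 ?pi_ge0 ?(ltW P0). Qed.

Let I_fin sb sc : (I sb sc < +oo)%E.
Proof.
have le := integral_le_indic mu mEE' K0 (@f_ge0 sb sc) (@f_le sb sc) (@f_out sb sc).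
apply: le_lt_trans le _.
by rewrite lte_mul_pinfty// ?lee_fin.
Qed.

(** The integrand is at least [nu / 4] on the curve, and the coarea factor in
    the denominator is at most [8 / P]. *)
Let I_triad : ((nu * P / 32)%:E <= I false true)%E.
Proof.
apply: (@le_trans _ _ ((nu * P / 32)%:E * mu E)%E).
  rewrite -[leLHS]mule1 lee_wpmul2l//; last exact: hausdorff1_triad.
  by rewrite lee_fin divr_ge0// mulr_ge0// ltW.
apply: integral_ge_indic.
- exact: mE.
- move=> _ [d /triad_segmentP dP <-]; split; first exact: resonant_triad.
  apply: lt0r_neq0; apply: lt_le_trans (coarea_triad_ge P100 dP _ _).
  by rewrite !divr_gt0.
- by rewrite divr_ge0// mulr_ge0// ltW.
- exact: f_ge0.
move=> _ [d /triad_segmentP dP <-]; rewrite /f row_mxKl row_mxKr.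
have J0 : 0 < coarea_factor alpha false true (triad P d).
  by apply: lt_le_trans (coarea_triad_ge P100 dP _ _); rewrite !divr_gt0.
rewrite ler_pdivlMr//.
apply: le_trans _ (collision_integrand_triad_ge m P100 eps8 chiP dP).
apply: (@le_trans _ _ (nu * P / 32 * (8 / P))).
  by rewrite ler_wpM2l ?coarea_triad_le// divr_ge0// mulr_ge0// ltW.
rewrite le_eqVlt; apply/orP; left; apply/eqP; rewrite -/nu; field.
by rewrite gt_eqF.
Qed.

Lemma collision_ge : nu * P / 32 <= collision chi n alpha.
Proof.
rewrite /collision (negbTE (kA_neq0 P100)).
exact: (fine_sum_bool_ge I_ge0 I_fin I_triad).
Qed.

Lemma wnorm_collision_ge : ((P / 32)%:E <= wnorm m (collision chi n))%E.
Proof.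
apply: (@le_trans _ _ (japanese (kA P) `^ m * `|collision chi n alpha|)%:E); last first.
  by apply: ereal_sup_ubound; exists alpha.
have N0 : 0 < P ^+ 2 by move: P2; lra.
have JP : P ^+ 2 <= japanese (kA P) by rewrite -(enorm_kA P100) enorm_le_japanese.
rewrite lee_fin; apply: (@le_trans _ _ ((P ^+ 2) `^ m * (nu * P / 32))).
  rewrite /nu powRN mulrA mulrA mulfV ?mul1r// gt_eqF// powR_gt0//.
apply: ler_pM; rewrite ?powR_ge0//.
- by rewrite divr_ge0// mulr_ge0// ltW.
- by rewrite ge0_ler_powR ?nnegrE ?(ltW m0) ?(ltW N0) ?sqrtr_ge0.
by apply: le_trans collision_ge (ler_norm _).
Qed.

End CollisionValue.

Unset Implicit Arguments.

Theorem lemma6p1 (R : realType) :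
  exists2 eps0 : R, 0 < eps0 &
  forall (eps : R) (chi : R -> R) (m : R),
    0 < eps < eps0 -> zero_frequency_cutoff eps chi -> 4 < m ->
    ~ bounded_map m (collision chi) /\
    exists eta : nat -> mode R -> R,
      [/\ forall n, Linfty m (eta n),
          (ereal_sup (range (fun n => wnorm m (eta n))) < +oo)%E &
          wnorm m (collision chi (eta n)) @[n --> \oo] --> +oo%E].
Proof.
(* All cosines of the triads are at least 49/100 in absolute value, hence
   greater than [2 eps], where the cut-off is 1. *)
exists (1 / 8); first by lra.
move=> eps chi m eps8 chiP m4.
have m0 : 0 < m by apply: lt_trans m4.
pose P n : R := n%:R + 100.
have P100 n : 100 <= P n by rewrite /P lerDr.
have etaK n : (wnorm m (density (P n) m) <= (7 `^ m)%:E)%E by exact: wnorm_density.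
have blowup n : ((P n / 32)%:E <= wnorm m (collision chi (density (P n) m)))%E.
  exact: wnorm_collision_ge eps8 chiP.
have etaL n : Linfty m (density (P n) m) by exact: density_Linfty.
split.
  move=> /(_ (7 `^ m))[K CK].
  have [N NK] : exists N : nat, 32 * K < N%:R.
    exists (Num.bound `|32 * K|).
    exact: le_lt_trans (ler_norm _) (archi_boundP (normr_ge0 _)).
  have := le_trans (blowup N) (CK _ (etaL N) (etaK N)).
  by rewrite lee_fin /P; move: NK; lra.
exists (fun n => density (P n) m); split => //.
  apply: le_lt_trans _ (ltry (7 `^ m)); apply: ge_ereal_sup => _ [n _ <-]; exact: etaK.
apply/cvgeyPge => A; have [N NA] : exists N : nat, 32 * A < N%:R.
  exists (Num.bound `|32 * A|).
  exact: le_lt_trans (ler_norm _) (archi_boundP (normr_ge0 _)).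
near=> n; apply: le_trans (blowup n); rewrite lee_fin /P.
have : (N%:R <= n%:R :> R) by rewrite ler_nat; near: n; exact: nbhs_infty_ge.
by move: NA; lra.
Unshelve. all: by end_near. Qed.
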